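(* Let $T\sim\{X_n\}_{n=1}^\infty$ be a random weighted shift on $\mathcal H$ with $R>0$, where $r=\min\operatorname{essran}X_1$ and $R=\max\operatorname{essran}X_1$. Then: (i) $\|T\|=\|T\|_e=\gamma(T)=w(T)=R$ a.s. (ii) $\sigma(T)=\sigma_\delta(T)=\overline{B(0,R)}$ a.s. (iii) $\sigma_\pi(T)=\sigma_e(T)=\sigma_{lre}(T)=\{z\in\mathbb C: r\le|z|\le R\}$ a.s., and almost surely $\operatorname{ind}(T-\lambda)=-1$ for all $\lambda\in B(0,r)$. (iv) If $\mathbb P(X_1=0)>0$, then almost surely $\sigma_p(T)=\sigma_p(T^* )=\{0\}$ and $\dim\ker T=\dim\ker T^*=\infty$. (v) If $\mathbb P(X_1=0)=0$, then almost surely $\sigma_p(T)=\emptyset$, $\sigma_p(T^* )=\{0\}\cup B(0,e^{\mathbb E(\ln X_1)})$, and $\dim\ker(T^*-\lambda)=1$ for all $\lambda\in\sigma_p(T^* )$. (vi) $W(T)=B(0,R)$ a.s. and $W_e(T)=\overline{B(0,R)}$ a.s.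
   Context: $\mathcal H$ is a complex separable infinite-dimensional Hilbert space with orthonormal basis $\{e_n\}_{n=1}^\infty$. $\{X_n\}_{n=1}^\infty$ are nonnegative, bounded, i.i.d. random variables on a probability space $(\Omega,\mathcal F,\mathbb P)$. Writing $T\sim\{X_n\}$ means that $T=T(\omega)$ is the random unilateral weighted shift $T(\omega)e_n=X_n(\omega)e_{n+1}$, $n\ge1$. $\operatorname{essran}X_1$ is the essential range of $X_1$ (closed support of its law). $B(z,\varepsilon)=\{\lambda\in\mathbb C:|\lambda-z|<\varepsilon\}$ (empty if $\varepsilon=0$) and $\overline{B(z,\varepsilon)}=\{\lambda:|\lambda-z|\le\varepsilon\}$. $\mathbb E(\ln X_1)\in[-\infty,\infty)$ and $e^{-\infty}=0$. For $A\in\mathcal B(\mathcal H)$: $\sigma(A)$ is the spectrum, $\gamma(A)$ the spectral radius, $\sigma_p(A)$ the point spectrum; $\|A\|_e=\inf\{\|A+K\|:K \text{ compact}\}$; $\sigma_\pi(A)=\{\lambda:A-\lambda\text{ is not bounded below}\}$; $\sigma_\delta(A)=\{\lambda:A-\lambda\text{ is not surjective}\}$; $\sigma_e(A)=\{\lambda: A-\lambda\text{ is not Fredholm}\}$; $\sigma_{lre}(A)=\{\lambda:A-\lambda\text{ is not semi-Fredholm}\}$; $\operatorname{ind}$ is the (semi-)Fredholm index $\dim\ker-\dim\ker(\cdot)^*$; $W(A)=\{\langle Ax,x\rangle:\|x\|=1\}$ is the numerical range, $w(A)=\sup_{z\in W(A)}|z|$ the numerical radius, and $W_e(A)=\bigcap_{K\text{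 compact}}\overline{W(A+K)}$ the essential numerical range. *)

(* Defs.v *)
From HB Require Import structures.
From mathcomp Require Import all_boot all_order all_algebra.
From mathcomp Require Import finmap complex.
From mathcomp Require Import all_classical all_reals all_analysis.

Set Implicit Arguments.
Unset Strict Implicit.
Unset Printing Implicit Defensive.

Import Order.TTheory GRing.Theory Num.Theory.
Import numFieldNormedType.Exports.

Local Open Scope classical_set_scope.
Local Open Scope ring_scope.
Local Open Scope complex_scope.

Section Probability.
Context d (Omega : measurableType d) (R : realType) (P : probability Omega R).

Definition mutually_independent (X : nat -> {RV P >-> R}) : Prop :=
  forall (J : {fset nat}) (B : nat -> set R),
    (forall j, j \in J -> measurable (B j)) ->
    P (\bigcap_(j in [set` J]) (X j @^-1` B j)) =
    (\prod_(j <- J) P (X j @^-1` B j))%E.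

Definition identically_distributed (X : nat -> {RV P >-> R}) : Prop :=
  forall n (B : set R), measurable B ->
    distribution P (X n) B = distribution P (X 0%N) B.

(* essential range: closed support of the law *)
Definition essran (Y : {RV P >-> R}) : set R :=
  [set x | forall eps : R, 0 < eps -> (0 < distribution P Y (ball x eps))%E].

Definition bounded_as (Y : {RV P >-> R}) : Prop :=
  exists M : R, {ae P, forall w, `|Y w| <= M}.

Definition nonneg_as (Y : {RV P >-> R}) : Prop := {ae P, forall w, 0 <= Y w}.

(* E (ln Y), with ln 0 = -oo *)
Definition expectation_ln (Y : {RV P >-> R}) : \bar R :=
  (\int[P]_w lne (Y w)%:E)%E.

End Probability.

(* Norms over R[i] are R[i]-valued (with zero imaginary part); [rnorm] is the
   same norm as an element of R. *)
Definition rnorm (R : rcfType) (V : normedZmodType R[i]) (v : V) : R :=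
  complex.Re `|v|.

Section Discs.
Context {R : realType}.

Definition odisc0 (rho : R) : set R[i] := [set z | rnorm z < rho].
Definition cdisc0 (rho : R) : set R[i] := [set z | rnorm z <= rho].
Definition annulus0 (rho1 rho2 : R) : set R[i] :=
  [set z | rho1 <= rnorm z <= rho2].

End Discs.

(* A complex Hilbert space is a complete normed module H over R[i] with a
   positive definite Hermitian form, linear in its first argument, that induces
   the norm. *)
Section HilbertOperators.
Context {R : realType} {H : completeNormedModType R[i]}.
Variable dot : {dot H for @Num.conj R[i]}.

Definition induces_norm : Prop := forall x : H, `|x| ^+ 2 = dot x x.

Definition orthonormal_basis (e : nat -> H) : Prop :=
  (forall i j, dot (e i) (e j) = (i == j)%:R) /\
  (forall x : H, series (fun n => dot x (e n) *: e n) @ \oo --> x).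

Implicit Types (A K : {linear H -> H}) (l : R[i]).

Definition op_norm A : R := sup [set rnorm (A x) | x in [set x | rnorm x <= 1]].

Definition compact_op A : Prop := precompact (A @` [set x | rnorm x <= 1]).

Definition ess_norm A : R := inf [set op_norm (A \+ K) | K in compact_op].

Definition sub_scalar A l : {linear H -> H} := A \- l \*: idfun.

(* The adjoint is unique, and exists for every bounded operator by the Riesz
   representation theorem; the value is unspecified otherwise. *)
Definition adjoint A : {linear H -> H} :=
  if pselect (exists B : {linear H -> H}, forall x y, dot (A x) y = dot x (B y))
    is left adjA then projT1 (cid adjA) else A.

Definition op_ker A : set H := [set x | A x = 0].

Definition is_basis (V : set H) n (b : 'I_n -> H) : Prop :=
  (forall c : 'I_n -> R[i], \sum_i c i *: b i = 0 -> forall i, c i = 0) /\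
  V = [set \sum_i c i *: b i | c in [set: 'I_n -> R[i]]].

(* dimension of a linear subspace, +oo if it has no finite basis *)
Definition dimension (V : set H) : \bar int :=
  xget +oo%E [set k | exists n (b : 'I_n -> H),
                        is_basis V b /\ k = (n%:Z)%:E].

Definition invertible_op A : Prop :=
  exists B : {linear H -> H},
    [/\ continuous B, cancel A B & cancel B A].

Definition bounded_below A : Prop :=
  exists2 c : R, 0 < c & forall x, c * rnorm x <= rnorm (A x).

Definition surjective_op A : Prop := range A = [set: H].

Definition fredholm A : Prop :=
  [/\ closed (range A), (dimension (op_ker A) < +oo)%E
    & (dimension (op_ker (adjoint A)) < +oo)%E].

Definition semi_fredholm A : Prop :=
  closed (range A) /\
  ((dimension (op_ker A) < +oo)%E \/ (dimension (op_ker (adjoint A)) < +oo)%E).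

(* meaningful for semi-Fredholm operators only, where at most one of the two
   terms is infinite *)
Definition op_index A : \bar int :=
  (dimension (op_ker A) - dimension (op_ker (adjoint A)))%E.

Definition spectrum A : set R[i] :=
  [set l | ~ invertible_op (sub_scalar A l)].
Definition point_spectrum A : set R[i] :=
  [set l | exists2 x : H, x != 0 & A x = l *: x].
Definition approx_point_spectrum A : set R[i] :=
  [set l | ~ bounded_below (sub_scalar A l)].
Definition surjectivity_spectrum A : set R[i] :=
  [set l | ~ surjective_op (sub_scalar A l)].
Definition ess_spectrum A : set R[i] :=
  [set l | ~ fredholm (sub_scalar A l)].
Definition lre_spectrum A : set R[i] :=
  [set l | ~ semi_fredholm (sub_scalar A l)].

Definition spectral_radius A : R := sup [set rnorm l | l in spectrum A].

Definition num_range A : set R[i] :=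
  [set dot (A x) x | x in [set x | rnorm x = 1]].

Definition num_radius A : R := sup [set rnorm z | z in num_range A].

Definition ess_num_range A : set R[i] :=
  \bigcap_(K in compact_op) closure (num_range (A \+ K) : set R[i]^o).

End HilbertOperators.

(* Main.v *)
Require Import Defs.
From HB Require Import structures.
From mathcomp Require Import all_boot all_order all_algebra.
From mathcomp Require Import finmap complex.
From mathcomp Require Import all_classical all_reals all_analysis.
From mathcomp Require Import measurable_realfun.
From mathcomp Require Import ring lra.

(** The theorem splits into a statement on a single weighted shift and a statement
    on sequences of independent variables.

    Deterministic part. Let [T] shift an orthonormal basis with weights [x n] in
    [[rmin, rmax]], and suppose that arbitrarily long windows of weights arbitrarily
    close to [rmax], followed by as many weights close to [rmin], occur arbitrarily
    far out. Since vectors are square-summable sequences of coordinates ([coord_inj]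
    and [riesz_fischer]), everything is a computation on coordinates. Off the
    annulus [rmin <= |l| <= rmax], [T - l] is bounded below, and it is onto when
    [|l| > rmax]. On the annulus, a window carries an approximate eigenvector
    ([approx_eigenvector]); as windows are disjoint, such vectors form an
    orthonormal sequence, and the range of [T - l] is not closed
    ([range_not_closed]). For [|l| < rmin] the operator [T - l] is injective, and
    the kernel of its adjoint is spanned by the vector with coordinates
    [m^n / (x_0 ... x_(n-1))], where [m] is the conjugate of [l]; whence the index
    [-1] and the failure of surjectivity. Every point of the open disc of radius
    [rmax] is attained by the quadratic form of [T] on orthonormal blocks
    ([num_range_block]), on which a compact operator is negligible
    ([compact_small]); this yields the numerical range, its essential version, the
    norm and the essential norm together.

    The eigenvalues of the adjoint. If infinitely many weights vanish, [T] is a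
    direct sum of finite nilpotent shifts. If none does, [l] is an eigenvalue of the
    adjoint if and only if [|l|^n / (x_0 ... x_(n-1))] is square summable. Its
    logarithm is a random walk with mean [ln |l| - E (ln X_0)] per step, and two
    facts decide the matter: a walk with negative drift is bounded above
    ([walk_bounded]), which gives geometric decay when [|l| < exp (E (ln X_0))]; and
    a walk with nonnegative drift does not tend to minus infinity
    ([walk_not_to_ninfty]), which excludes all other nonzero [l], the critical
    circle included.

    Probabilistic part. The sequence of weights is transported to the space of real
    sequences, where its law is invariant under the shift and cylinders are
    independent of later events ([mu_cylinder_shift]). It follows that patterns of
    positive probability occur infinitely often ([windows_io]) and that invariant
    events are trivial ([shift_invariant01]). The two facts on walks are proved by
    Garsia's method: the running maximum [M] of a walk with steps [f] satisfies
    [M v - M (shift v) = max (f (v 0)) (- M (shift v))], and the integral of the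
    left-hand side is controlled by invariance. *)

Set Implicit Arguments.
Unset Strict Implicit.
Unset Printing Implicit Defensive.
Import Order.TTheory GRing.Theory Num.Theory.
Import numFieldNormedType.Exports.
Local Open Scope classical_set_scope.
Local Open Scope ring_scope.
Local Open Scope complex_scope.

(** * Real-valued norms *)

Section Rnorm.
Variables (R : realType) (V : normedModType R[i]).
Implicit Types (u v : V) (a : R[i]).

Lemma rnormE (W : normedZmodType R[i]) (v : W) : `|v| = (rnorm v)%:C.
Proof. by rewrite /rnorm RRe_real// normr_real. Qed.

Lemma rnorm_ge0 (W : normedZmodType R[i]) (v : W) : 0 <= rnorm v.
Proof. by rewrite -lecR -rnormE normr_ge0. Qed.

Lemma rnormD (W : normedZmodType R[i]) (u v : W) : rnorm (u + v) <= rnorm u + rnorm v.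
Proof. by rewrite -lecR rmorphD /= -!rnormE ler_normD. Qed.

Lemma rnormN (W : normedZmodType R[i]) (u : W) : rnorm (- u) = rnorm u.
Proof. by rewrite /rnorm normrN. Qed.

Lemma rnormC (W : normedZmodType R[i]) (u v : W) : rnorm (u - v) = rnorm (v - u).
Proof. by rewrite -rnormN opprB. Qed.

Lemma rnorm0 (W : normedZmodType R[i]) : rnorm (0 : W) = 0.
Proof. by rewrite /rnorm normr0. Qed.

Lemma rnorm0_eq0 (W : normedZmodType R[i]) (v : W) : rnorm v = 0 -> v = 0.
Proof. by move=> h; apply/normr0_eq0; rewrite rnormE h. Qed.

Lemma rnorm_gt0 (W : normedZmodType R[i]) (v : W) : v != 0 -> 0 < rnorm v.
Proof.
move=> v0; rewrite lt_def rnorm_ge0 andbT; apply: contra v0 => /eqP /rnorm0_eq0 ->.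
exact: eqxx.
Qed.

Lemma rnormB_ge (W : normedZmodType R[i]) (u v : W) : rnorm u - rnorm v <= rnorm (u - v).
Proof. by rewrite lerBlDr -{1}(subrK v u) rnormD. Qed.

Lemma rnorm_tri (W : normedZmodType R[i]) (u v w : W) :
  rnorm (u - w) <= rnorm (u - v) + rnorm (v - w).
Proof. by rewrite -{1}(subrK v u) -addrA rnormD. Qed.

Lemma rnormM a b : rnorm (a * b) = rnorm a * rnorm b.
Proof. by apply: complexI; rewrite rmorphM /= -!rnormE normrM. Qed.

Lemma rnormX a n : rnorm (a ^+ n) = rnorm a ^+ n.
Proof. by apply: complexI; rewrite rmorphXn /= -!rnormE normrX. Qed.

Lemma rnormV a : rnorm (a^-1) = (rnorm a)^-1.
Proof. by apply: complexI; rewrite fmorphV /= -!rnormE normfV. Qed.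

Lemma rnorm1 : rnorm (1 : R[i]) = 1.
Proof. by rewrite /rnorm normr1. Qed.

Lemma rnormZ a v : rnorm (a *: v) = rnorm a * rnorm v.
Proof. by apply: complexI; rewrite rmorphM /= -!rnormE normrZ. Qed.

Lemma rnorm_real (r : R) : rnorm (r%:C) = `|r|.
Proof. by rewrite /rnorm normc_def /= expr0n addr0 sqrtr_sqr. Qed.

Lemma rnorm_conj a : rnorm (a^*)%C = rnorm a.
Proof. by rewrite /rnorm normcJ. Qed.

Lemma rnorm_Conj a : rnorm (Num.conj a) = rnorm a.
Proof. exact: rnorm_conj. Qed.

Lemma mulJ_rnorm a : a * Num.conj a = (rnorm a ^+ 2)%:C.
Proof. by rewrite rmorphXn /= -rnormE sqr_normc. Qed.

Lemma cvg_rnormP (u : nat -> V) (l : V) :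
  u @ \oo --> l <->
  forall eps : R, 0 < eps -> exists N, forall n, (N <= n)%N -> rnorm (u n - l) < eps.
Proof.
split=> [/cvgrPdistC_lt h eps e0|h].
  have /h [N _ hN] : 0 < eps%:C by rewrite ltcR.
  by exists N => n /hN /=; rewrite rnormE ltcR.
apply/cvgrPdistC_lt => eps; rewrite ltcE /= => /andP[/eqP im0 /h[N hN]].
exists N => // n /= /hN; rewrite rnormE (complexE eps) im0 mulr0 addr0.
by rewrite ltcR.
Qed.

Lemma closure_rnormP (A : set V) (l : V) :
  closure A l <-> forall eps : R, 0 < eps -> exists2 v, A v & rnorm (v - l) < eps.
Proof.
split=> [h eps e0|h B].
  have /h [v [Av /=]] : nbhs l (ball l eps%:C) by apply: nbhsx_ballx; rewrite ltcR.
  rewrite -ball_normE /= => lv; exists v => //.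
  by move: lv; rewrite rnormE ltcR rnormC.
move=> /nbhs_ballP [eps /=]; rewrite ltcE /= => /andP[/eqP im0 /h [v Av lv]] sB.
exists v; split => //; apply: sB; rewrite -ball_normE /= rnormE (complexE eps) im0 mulr0 addr0.
by rewrite ltcR rnormC.
Qed.

(** The norm of [V] takes its values in [R[i]]; here and below it is replaced by
    [rnorm], so that all estimates take place in the ordered field [R]. *)
Lemma linear_bounded_rnormP (W : normedModType R[i]) (A : {linear V -> W}) :
  continuous A <-> exists2 M : R, 0 < M & forall v, rnorm (A v) <= M * rnorm v.
Proof.
split=> [/linear_bounded_continuous/linear_boundedP/pinfty_ex_gt0[r r0 h]|[M M0 h]].
  move: r0 h; rewrite ltcE /= => /andP[/eqP im0 r0] h; exists (complex.Re r) => // v.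
  rewrite -lecR rmorphM /= -!rnormE; move: (h v); rewrite {1}(complexE r) im0 mulr0 addr0.
  by [].
apply/linear_bounded_continuous/linear_boundedP.
have M0' : 0 < M%:C by rewrite ltcR.
exists M%:C; split; first by rewrite ger0_real// ltW.
move=> r rM v.
rewrite (le_trans _ (ler_wpM2r _ (ltW rM)))// rnormE (rnormE v).
by rewrite -rmorphM lecR.
Qed.

Lemma rnorm_cauchy_cvg (W : completeNormedModType R[i]) (u : nat -> W) :
  (forall eps : R, 0 < eps -> exists N, forall m n, (N <= m)%N -> (N <= n)%N ->
     rnorm (u m - u n) < eps) -> exists l : W, u @ \oo --> l.
Proof.
move=> h; suff /cvg_ex : cvgn u by [].
apply/cauchy_cvgP/cauchy_ballP => eps.
rewrite ltcE /= => /andP[/eqP im0 /h[N hN]].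
have inS : (u @ \oo) (u @` [set n | (N <= n)%N]).
  by exists N => // n /= Nn; exists n.
exists (u @` [set n | (N <= n)%N], u @` [set n | (N <= n)%N]) => //=.
move=> [_ _] /= [[m Nm <-] [n Nn <-]]; 
rewrite -ball_normE /= rnormE (complexE eps) im0 mulr0 addr0 ltcR.
exact: hN.
Qed.

(** Compact operators enter only through the cluster points of the images of
    bounded sequences. *)
Lemma precompact_cluster (S : set V) (u : nat -> V) :
  precompact S -> (forall n, S (u n)) ->
  exists l : V, forall (eps : R) N, 0 < eps -> exists2 n, (N <= n)%N & rnorm (u n - l) < eps.
Proof.
rewrite precompactE => cS Su.
have [|l [_ cl]] := cS (u @ \oo) _.
  by exists 0%N => // n _; apply: subset_closure; exact: Su.
exists l => eps N e0.
have [] := cl (u @` [set n | (N <= n)%N]) (ball l eps%:C).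
- by exists N => // n /= Nn; exists n.
- by apply: nbhsx_ballx; rewrite ltcR.
move=> v [[n /= Nn <-]]; rewrite -ball_normE /= rnormE ltcR => h.
by exists n => //; rewrite rnormC.
Qed.

End Rnorm.

(** * Inner products and orthonormal bases *)

Section Inner.
Variables (R : realType) (H : completeNormedModType R[i]).
Variable dot : {dot H for @Num.conj R[i]}.
Hypothesis dot_norm : induces_norm dot.
Implicit Types (u v w : H) (a : R[i]).

Lemma dotDl u v w : dot (u + v) w = dot u w + dot v w.
Proof. exact: linearDl. Qed.

Lemma dotDr u v w : dot w (u + v) = dot w u + dot w v.
Proof. exact: linearDr. Qed.

Lemma dotZl a u v : dot (a *: u) v = a * dot u v.
Proof. exact: linearZl_LR. Qed.

Lemma dotZr a u v : dot u (a *: v) = Num.conj a * dot u v.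
Proof. exact: linearZr_LR. Qed.

Lemma dotNl u v : dot (- u) v = - dot u v.
Proof. by rewrite -scaleN1r dotZl mulN1r. Qed.

Lemma dotNr u v : dot u (- v) = - dot u v.
Proof. by rewrite -scaleN1r dotZr rmorphN rmorph1 mulN1r. Qed.

Lemma dotBl u v w : dot (u - v) w = dot u w - dot v w.
Proof. by rewrite dotDl dotNl. Qed.

Lemma dotBr u v w : dot w (u - v) = dot w u - dot w v.
Proof. by rewrite dotDr dotNr. Qed.

Lemma dot0l u : dot 0 u = 0.
Proof. by rewrite -(scale0r 0) dotZl mul0r. Qed.

Lemma dot0r u : dot u 0 = 0.
Proof. by rewrite -(scale0r 0) dotZr rmorph0 mul0r. Qed.

Lemma dot_conj u v : dot u v = Num.conj (dot v u).
Proof. by rewrite hermC expr0 mul1r. Qed.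

Lemma dot_suml I (r : seq I) (f : I -> H) v :
  dot (\sum_(i <- r) f i) v = \sum_(i <- r) dot (f i) v.
Proof.
elim: r => [|i r IH]; first by rewrite !big_nil dot0l.
by rewrite !big_cons dotDl IH.
Qed.

Lemma dot_sumr I (r : seq I) (f : I -> H) v :
  dot v (\sum_(i <- r) f i) = \sum_(i <- r) dot v (f i).
Proof.
elim: r => [|i r IH]; first by rewrite !big_nil dot0r.
by rewrite !big_cons dotDr IH.
Qed.

Lemma dotvv v : dot v v = (rnorm v ^+ 2)%:C.
Proof. by rewrite -dot_norm rnormE rmorphXn. Qed.

(** Equality in the Cauchy-Schwarz inequality forces [u] to be a multiple of [v];
    this identity is used both for the inequality and for its equality case. *)
Lemma rnorm_sub_proj u v : rnorm v = 1 ->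
  rnorm (u - dot u v *: v) ^+ 2 = rnorm u ^+ 2 - rnorm (dot u v) ^+ 2.
Proof.
move=> v1; apply: complexI; rewrite -dotvv rmorphB /= -!dotvv -mulJ_rnorm.
rewrite !(dotBl, dotBr, dotZl, dotZr) (dotvv v) v1 expr1n (dot_conj v u) rmorph1.
by ring.
Qed.

(** By [rnorm_sub_proj] applied to the normalization of [v]. *)
Lemma cauchy_schwarz u v : rnorm (dot u v) <= rnorm u * rnorm v.
Proof.
have [->|v0] := eqVneq v 0; first by rewrite dot0r !rnorm0 mulr0.
have v0' := rnorm_gt0 v0.
pose v1 := (rnorm v)^-1%:C *: v.
have n1 : rnorm v1 = 1.
  by rewrite rnormZ rnorm_real ger0_norm ?invr_ge0 ?rnorm_ge0// mulVf// gt_eqF.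
have : rnorm (dot u v1) <= rnorm u.
  rewrite -ler_sqr ?nnegrE ?rnorm_ge0// -subr_ge0 -rnorm_sub_proj//.
  exact: sqr_ge0.
rewrite dotZr rnormM rnorm_Conj rnorm_real ger0_norm ?invr_ge0 ?rnorm_ge0//.
by rewrite ler_pdivrMl// mulrC.
Qed.

Lemma pythagoras u v : dot u v = 0 -> rnorm (u + v) ^+ 2 = rnorm u ^+ 2 + rnorm v ^+ 2.
Proof.
move=> uv; apply: complexI; rewrite -dotvv rmorphD /= -!dotvv.
by rewrite !(dotDl, dotDr) (dot_conj v u) uv rmorph0; ring.
Qed.

Lemma dot_cvg (u : nat -> H) (l : H) : u @ \oo --> l -> forall v (eps : R), 0 < eps ->
  exists N, forall n, (N <= n)%N -> rnorm (dot (u n) v - dot l v) < eps.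
Proof.
move=> /cvg_rnormP ul v eps e0.
have d0 : 0 < rnorm v + 1 by rewrite ltr_wpDl// rnorm_ge0.
have [N hN] := ul (eps / (rnorm v + 1)) (divr_gt0 e0 d0).
exists N => n /hN h; rewrite -dotBl (le_lt_trans (cauchy_schwarz _ _))//.
move: h; rewrite ltr_pdivlMr// => h; apply: le_lt_trans h.
by rewrite ler_wpM2l ?rnorm_ge0// lerDl.
Qed.

(** The coordinates of the approximants used below are eventually constant, so that
    limits are computed by evaluating one term. *)
Lemma dot_cvg_const (u : nat -> H) (l : H) v a N0 : u @ \oo --> l ->
  (forall n, (N0 <= n)%N -> dot (u n) v = a) -> dot l v = a.
Proof.
move=> ul h; apply/eqP; rewrite -subr_eq0; apply/eqP/rnorm0_eq0.
apply/eqP; rewrite eq_le rnorm_ge0 andbT; apply/ler_addgt0Pr => eps e0.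
rewrite add0r; have [N hN] := dot_cvg ul v e0.
rewrite rnormC ltW//; have := hN (maxn N N0) (leq_maxl _ _).
by rewrite h ?leq_maxr.
Qed.

Lemma orthonormal_bessel (u : nat -> H) : (forall j, rnorm (u j) = 1) ->
  (forall i j, i != j -> dot (u i) (u j) = 0) ->
  forall v N, \sum_(0 <= j < N) rnorm (dot v (u j)) ^+ 2 <= rnorm v ^+ 2.
Proof.
move=> u1 u0 v N; pose s n := \sum_(0 <= j < n) dot v (u j) *: u j.
have su n : dot (v - s n) (u n) = dot v (u n).
  rewrite dotBl dot_suml big1_seq ?subr0// => j; rewrite mem_index_iota => /= jn.
  by rewrite dotZl u0 ?mulr0// ltn_eqF.
suff : rnorm (v - s N) ^+ 2 = rnorm v ^+ 2 - \sum_(0 <= j < N) rnorm (dot v (u j)) ^+ 2.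
  by move=> h; rewrite -subr_ge0 -h sqr_ge0.
elim: N => [|N IH]; first by rewrite /s !big_geq// !subr0.
have -> : v - s N.+1 = (v - s N) - dot (v - s N) (u N) *: u N.
  by rewrite su /s big_nat_recr//= opprD addrA.
by rewrite rnorm_sub_proj// IH su big_nat_recr//= opprD addrA.
Qed.

(** Infinitely many large coefficients would contradict [orthonormal_bessel]. *)
Lemma orthonormal_small (u : nat -> H) : (forall j, rnorm (u j) = 1) ->
  (forall i j, i != j -> dot (u i) (u j) = 0) ->
  forall v (eps : R), 0 < eps -> exists N, forall n, (N <= n)%N -> rnorm (dot v (u n)) < eps.
Proof.
move=> u1 u0 v eps e0; apply: contrapT => h.
have {}h N : exists2 n, (N <= n)%N & eps <= rnorm (dot v (u n)).
  apply: contrapT => h'; apply: h; exists N => n Nn; rewrite ltNge; apply/negP => en.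
  by apply: h'; exists n.
have grow m : exists N, m%:R * eps ^+ 2 <= \sum_(0 <= j < N) rnorm (dot v (u j)) ^+ 2.
  elim: m => [|m [N hN]]; first by exists 0%N; rewrite mul0r big_geq.
  have [n Nn en] := h N; exists n.+1.
  rewrite big_nat_recr//= -natr1 mulrDl mul1r lerD//; last first.
    by rewrite ler_sqr ?nnegrE ?rnorm_ge0// ltW.
  rewrite (le_trans hN)// [leRHS](big_cat_nat (n := N))//= lerDl sumr_ge0// => k _.
  exact: sqr_ge0.
pose m := (Num.truncn (rnorm v ^+ 2 / eps ^+ 2)).+1.
have [N hN] := grow m; have := le_trans hN (orthonormal_bessel u1 u0 v N).
rewrite -ler_pdivlMr ?exprn_gt0//; apply/negP; rewrite -ltNge.
exact: truncnS_gt.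
Qed.

Section Onb.
Variable e : nat -> H.
Hypothesis e_onb : orthonormal_basis dot e.

Definition fsum (c : nat -> R[i]) N : H := \sum_(0 <= k < N) c k *: e k.

Lemma dot_ee i j : dot (e i) (e j) = (i == j)%:R.
Proof. by case: e_onb. Qed.

Lemma fsumS c N : fsum c N.+1 = fsum c N + c N *: e N.
Proof. by rewrite /fsum big_nat_recr. Qed.

Lemma dot_fsum c N i : dot (fsum c N) (e i) = if (i < N)%N then c i else 0.
Proof.
elim: N => [|N IH]; first by rewrite /fsum big_geq// dot0l.
rewrite fsumS dotDl dotZl dot_ee ltnS leq_eqVlt (eq_sym N) IH.
case: eqVneq => [->|_] /=; first by rewrite ltnn mulr1 add0r.
by rewrite mulr0 addr0.
Qed.

Lemma rnorm_fsum c N : rnorm (fsum c N) ^+ 2 = \sum_(0 <= k < N) rnorm (c k) ^+ 2.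
Proof.
elim: N => [|N IH]; first by rewrite /fsum !big_geq// rnorm0 expr0n.
rewrite fsumS pythagoras; last by rewrite dotZr dot_fsum ltnn mulr0.
rewrite big_nat_recr//= -IH; congr (_ + _); apply: complexI.
by rewrite -dotvv dotZl dotZr dot_ee eqxx mulr1 mulJ_rnorm.
Qed.

Lemma rnorm_e n : rnorm (e n) = 1.
Proof.
have := dotvv (e n); rewrite dot_ee eqxx => /(congr1 (@complex.Re _)) /= h.
by apply/eqP; rewrite -sqrp_eq1 ?rnorm_ge0// -h.
Qed.

Lemma e_neq0 n : e n != 0.
Proof.
apply/eqP => e0; have := rnorm_e n; rewrite e0 rnorm0 => /eqP.
by rewrite eq_sym oner_eq0.
Qed.

Lemma dot_fsumv c N v :
  dot v (fsum c N) = \sum_(0 <= k < N) Num.conj (c k) * dot v (e k).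
Proof. by rewrite dot_sumr; apply: eq_bigr => k _; rewrite dotZr. Qed.

Lemma fsum_cvg v : fsum (fun n => dot v (e n)) @ \oo --> v.
Proof. by have [_] := e_onb; exact. Qed.

Lemma bessel v N : \sum_(0 <= k < N) rnorm (dot v (e k)) ^+ 2 <= rnorm v ^+ 2.
Proof.
by apply: orthonormal_bessel => [j|i j ij]; rewrite ?rnorm_e// dot_ee (negPf ij).
Qed.

(** By density of the finite sums; together with [bessel] this is Parseval's
    identity. *)
Lemma parseval_le v (C : R) : 0 <= C ->
  (forall N, \sum_(0 <= k < N) rnorm (dot v (e k)) ^+ 2 <= C ^+ 2) -> rnorm v <= C.
Proof.
move=> C0 h; apply/ler_addgt0Pr => eps e0.
have /cvg_rnormP /(_ eps e0)[N hN] := @fsum_cvg v.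
have := hN N (leqnn _); rewrite rnormC => h1.
have := rnormD (v - fsum (fun n => dot v (e n)) N) (fsum (fun n => dot v (e n)) N).
rewrite subrK => /le_trans; apply; rewrite addrC lerD// ?(ltW h1)//.
by rewrite -ler_sqr ?nnegrE ?rnorm_ge0// rnorm_fsum.
Qed.

Lemma coord_inj u v : (forall n, dot u (e n) = dot v (e n)) -> u = v.
Proof.
move=> h; apply/eqP; rewrite -subr_eq0; apply/eqP/rnorm0_eq0/eqP.
rewrite eq_le rnorm_ge0 andbT; apply: parseval_le => // N.
by rewrite big1 ?expr0n// => k _; rewrite dotBl h subrr rnorm0 expr0n.
Qed.

(** Bounded partial sums have a nondecreasing bounded sequence of squared norms,
    hence are Cauchy by Pythagoras. With [coord_inj] this identifies the space
    with the square-summable sequences, and operators are built coordinatewise. *)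
Lemma riesz_fischer (c : nat -> R[i]) (C : R) :
  (forall N, rnorm (fsum c N) <= C) -> exists v, forall n, dot v (e n) = c n.
Proof.
move=> h.
pose s N := \sum_(0 <= k < N) rnorm (c k) ^+ 2.
have C0 : 0 <= C by rewrite (le_trans _ (h 0%N))// rnorm_ge0.
have sC N : s N <= C ^+ 2.
  by rewrite /s -rnorm_fsum ler_sqr// ?nnegrE ?rnorm_ge0.
have sS : {homo s : m n / (m <= n)%N >-> m <= n}.
  apply: homo_leq => [x|x y z|n]; [exact: lexx|exact: le_trans|].
  by rewrite /s big_nat_recr//= lerDl sqr_ge0.
have dist m n : (m <= n)%N -> rnorm (fsum c n - fsum c m) ^+ 2 = s n - s m.
  move=> /subnKC <-; elim: (n - m)%N => [|k IH]; first by rewrite addn0 !subrr rnorm0 expr0n.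
  rewrite addnS fsumS -addrA (addrC (_ *: _)) addrA pythagoras; last first.
    rewrite dotZr dotBl !dot_fsum ltnn ltnNge leq_addr /= subrr mulr0//.
  rewrite IH /s big_nat_recr//= rnormZ rnorm_e mulr1.
  by rewrite addrAC.
have supS : has_sup (range s).
  by split; [by exists (s 0%N), 0%N|exists (C ^+ 2) => _ [n _ <-]].
have [l hl] : exists l : H, fsum c @ \oo --> l.
  apply: rnorm_cauchy_cvg => eps e0.
  have [_ [N _ <-] hN] := @sup_adherent _ _ (eps ^+ 2) (exprn_gt0 2 e0) supS.
  exists N.
  suff key m n : (N <= m)%N -> (m <= n)%N -> rnorm (fsum c n - fsum c m) < eps.
    move=> m n Nm Nn; have [mn|/ltnW nm] := leqP m n; last exact: key.
    by rewrite rnormC; exact: key.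
  move=> Nm mn; rewrite -ltr_sqr ?nnegrE ?rnorm_ge0 ?ltW// dist//.
  have : s n <= sup (range s) by have [_ ub] := supS; apply: (sup_ubound ub); exists n.
  have := sS _ _ Nm; move: hN; lra.
exists l => n; apply: (dot_cvg_const (N0 := n.+1) hl) => m nm.
by rewrite dot_fsum nm.
Qed.

End Onb.

End Inner.

(** * Dimension *)

Section Dimension.
Variables (R : realType) (H : completeNormedModType R[i]).
Implicit Types V : set H.

(** A family longer than a spanning one is linearly dependent: its coefficient
    matrix has a nonzero left kernel. *)
Lemma basis_size_ge V n (b : 'I_n -> H) m (f : 'I_m -> H) : is_basis V b ->
  (forall i, V (f i)) ->
  (forall c : 'I_m -> R[i], \sum_i c i *: f i = 0 -> forall i, c i = 0) -> (m <= n)%N.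
Proof.
move=> [_ VE] Vf free; rewrite leqNgt; apply/negP => nm.
have /choice[a ha] i : exists a : 'I_n -> R[i], f i = \sum_j a j *: b j.
  by have := Vf i; rewrite VE => -[a _ <-]; exists a.
pose M : 'M[R[i]]_(m, n) := \matrix_(i, j) a i j.
have : kermx M != 0.
  rewrite -mxrank_eq0 mxrank_ker subn_eq0 -ltnNge.
  exact: leq_ltn_trans (rank_leq_col _) nm.
move=> /rowV0Pn[v /sub_kermxP vM /eqP]; apply.
apply/rowP => i; rewrite mxE; apply: (free (fun i => v 0 i)).
under eq_bigr do rewrite ha scaler_sumr.
rewrite exchange_big big1// => j _.
under eq_bigr do rewrite scalerA.
rewrite -scaler_suml; have := congr1 (fun A : 'rV_n => A 0 j) vM; rewrite !mxE => vMj.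
rewrite (_ : \sum_i _ = 0) ?scale0r// -[RHS]vMj; apply: eq_bigr => k _.
by rewrite mxE.
Qed.

Lemma dimensionE V n (b : 'I_n -> H) : is_basis V b -> dimension V = (n%:Z)%:E.
Proof.
move=> Vb; rewrite /dimension.
have bV m (b' : 'I_m -> H) : is_basis V b' -> forall i, V (b' i).
  move=> [_ ->] i; exists (fun j => (j == i)%:R) => //.
  rewrite (bigD1 i)//= eqxx scale1r big1 ?addr0// => j /negPf ->.
  by rewrite scale0r.
case: xgetP => [k -> [m [b' [Vb' ->]]]|/(_ (n%:Z)%:E) H0]; last first.
  by exfalso; apply: H0; exists n, b.
congr ((_%:Z)%:E); apply/eqP; rewrite eqn_leq; apply/andP; split.
  by apply: (basis_size_ge Vb (bV _ _ Vb')); case: Vb'.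
by apply: (basis_size_ge Vb' (bV _ _ Vb)); case: Vb.
Qed.

Lemma dimension0 V : V = [set 0] -> dimension V = 0%:E.
Proof.
move=> ->; rewrite (@dimensionE _ 0 (fun=> 0))//; split; first by move=> c _ [].
apply/seteqP; split => [_ ->|_ [c _ <-]]; last by rewrite big_ord0.
by exists (fun=> 0) => //; rewrite big_ord0.
Qed.

Lemma dimension1 V v : v != 0 -> V = [set a *: v | a in setT] -> dimension V = 1%:E.
Proof.
move=> v0 ->; rewrite (@dimensionE _ 1 (fun=> v))//; split.
  move=> c; rewrite big_ord1 => /eqP; rewrite scaler_eq0 (negPf v0) orbF => /eqP c0 i.
  by rewrite ord1.
apply/seteqP; split => _ [a _ <-]; last by exists (a ord0) => //; rewrite big_ord1.
by exists (fun=> a) => //; rewrite big_ord1.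
Qed.

(** The size of a basis would bound the size of independent families. *)
Lemma dimension_infty V : (forall m, exists2 f : 'I_m -> H, forall i, V (f i) &
  forall c : 'I_m -> R[i], \sum_i c i *: f i = 0 -> forall i, c i = 0) ->
  dimension V = +oo%E.
Proof.
move=> h; rewrite /dimension; apply: xgetPN => k [n [b [Vb _]]].
have [f Vf free] := h n.+1.
by have := basis_size_ge Vb Vf free; rewrite ltnn.
Qed.

End Dimension.

(** * Operators bounded below, adjoints and compact operators *)

Section Operators.
Variables (R : realType) (H : completeNormedModType R[i]).
Implicit Types (A K : {linear H -> H}) (l : R[i]).

Lemma sub_scalarE (A : {linear H -> H}) l v : sub_scalar A l v = A v - l *: v.
Proof. by []. Qed.

Lemma op_ker_sub0 (A : {linear H -> H}) : op_ker (sub_scalar A 0) = op_ker A.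
Proof. by apply/seteqP; split => v; rewrite /op_ker /mkset sub_scalarE scale0r subr0. Qed.

Lemma bounded_below_inj (A : {linear H -> H}) : bounded_below A ->
  forall u v, A u = A v -> u = v.
Proof.
move=> [c c0 hc] u v uv; apply/eqP; rewrite -subr_eq0; apply/eqP/rnorm0_eq0/eqP.
rewrite eq_le rnorm_ge0 andbT -(pmulr_rle0 _ c0) (le_trans (hc _))//.
by rewrite linearB uv subrr rnorm0.
Qed.

Lemma ker_bounded_below (A : {linear H -> H}) : bounded_below A -> op_ker A = [set 0].
Proof.
move=> bA; apply/seteqP; split => v; rewrite /op_ker /mkset; last by move=> ->; rewrite linear0.
by move=> h; apply: (bounded_below_inj bA); rewrite h linear0.
Qed.

(** The lower bound is the continuity of the inverse. *)
Lemma invertible_of_bounded_below (A : {linear H -> H}) :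
  bounded_below A -> surjective_op A -> invertible_op A.
Proof.
move=> bA sA; have inj := bounded_below_inj bA; have [c c0 hc] := bA.
have /choice[B hB] y : exists z, A z = y.
  by have : range A y; [rewrite sA|move=> -[z _ <-]; exists z].
have Blin : linear B by move=> a u v; apply: inj; rewrite linearP !hB.
pose BL : {linear H -> H} := HB.pack B (GRing.isLinear.Build _ _ _ _ B Blin).
exists BL; split; [|by move=> v; apply: inj; rewrite /= hB|by move=> v; rewrite /= hB].
apply/linear_bounded_rnormP; exists c^-1; rewrite ?invr_gt0// => v /=.
by rewrite ler_pdivlMl// (le_trans (hc _))// hB.
Qed.

Lemma invertible_surjective (A : {linear H -> H}) : invertible_op A -> surjective_op A.
Proof. by move=> [B [_ _ BA]]; apply/seteqP; split => // y _; exists (B y). Qed.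

Lemma bounded_below_closed_range (A : {linear H -> H}) : continuous A ->
  bounded_below A -> closed (range A).
Proof.
move=> /linear_bounded_rnormP[M M0 hM] [c c0 hc] y /closure_rnormP cy.
have /choice[u hu] n : exists v, rnorm (A v - y) < n.+1%:R^-1.
  by have [|_ [v _ <-] h] := cy n.+1%:R^-1; [rewrite invr_gt0|exists v].
have inv_small (eps : R) : 0 < eps -> exists N, forall n, (N <= n)%N -> n.+1%:R^-1 < eps.
  move=> e0; exists (Num.truncn eps^-1) => n Nn.
  rewrite invf_plt ?posrE// (lt_le_trans (truncnS_gt _))// ler_nat.
  by rewrite ltnS.
have [v /cvg_rnormP uv] : exists v : H, u @ \oo --> v.
  apply: rnorm_cauchy_cvg => eps e0.
  have [|N hN] := inv_small (c * (eps / 2)); first by rewrite mulr_gt0 ?divr_gt0.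
  exists N => m n Nm Nn; rewrite -(ltr_pM2l c0) (le_lt_trans (hc _))// linearB.
  rewrite (le_lt_trans (rnorm_tri _ y _))// (rnormC y).
  have := lt_trans (hu m) (hN m Nm); have := lt_trans (hu n) (hN n Nn); lra.
exists v => //; apply/eqP; rewrite -subr_eq0; apply/eqP/rnorm0_eq0/eqP.
rewrite eq_le rnorm_ge0 andbT; apply/ler_addgt0Pr => eps e0; rewrite add0r.
have [|N1 h1] := uv (eps / 2 / M); first by rewrite !divr_gt0.
have [|N2 h2] := inv_small (eps / 2); first by rewrite !divr_gt0.
set n := maxn N1 N2.
apply: le_trans (rnorm_tri _ (A (u n)) _) _; rewrite -linearB.
have := hM (v - u n); have := h1 n (leq_maxl _ _).
rewrite (rnormC v) ltr_pdivlMr// (mulrC _ M).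
by have := lt_trans (hu n) (h2 n (leq_maxr _ _)); rewrite rnormC; lra.
Qed.

(** A sequence of values with norms tending to infinity has no cluster point. *)
Lemma compact_bounded (K : {linear H -> H}) : compact_op K ->
  exists C : R, forall v, rnorm v <= 1 -> rnorm (K v) <= C.
Proof.
move=> cK; apply: contrapT => h.
have /choice[u hu] (n : nat) : exists v, rnorm v <= 1 /\ n%:R < rnorm (K v).
  apply: contrapT => h'; apply: h; exists n%:R => v v1; rewrite leNgt; apply/negP => nK.
  by apply: h'; exists v.
have [|l hl] := precompact_cluster (u := fun j => K (u j)) cK.
  by move=> n; exists (u n) => //=; case: (hu n).
have [n Nn hn] := hl 1 (Num.truncn (rnorm l + 1)).+1 ltr01.
have := rnormB_ge (K (u n)) l; have [_ h1] := hu n.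
have : rnorm l + 1 < n%:R by rewrite (lt_le_trans (truncnS_gt _))// ler_nat.
lra.
Qed.

Lemma compact_op0 : compact_op (\0 : {linear H -> H}).
Proof.
apply: (@precompact_subset _ _ [set 0]); first by move=> _ [v _ <-].
rewrite precompact_closed; first exact: compact_set1.
by apply: compact_closed; [exact: norm_hausdorff|exact: compact_set1].
Qed.

Variable dot : {dot H for @Num.conj R[i]}.

Lemma fredholm_semi (A : {linear H -> H}) : fredholm dot A -> semi_fredholm dot A.
Proof. by move=> [h1 h2 _]; split => //; left. Qed.

Definition has_adjoint (A : {linear H -> H}) :=
  exists B : {linear H -> H}, forall x y, dot (A x) y = dot x (B y).

Lemma adjointP A : has_adjoint A -> forall x y, dot (A x) y = dot x (adjoint dot A y).
Proof.
by move=> hA; rewrite /adjoint; case: pselect => // h; exact: (projT2 (cid h)).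
Qed.

Lemma adjoint_dotE A y z : has_adjoint A ->
  dot (adjoint dot A y) z = Num.conj (dot (A z) y).
Proof. by move=> hA; rewrite dot_conj -adjointP. Qed.

Lemma has_adjoint_sub A l : has_adjoint A -> has_adjoint (sub_scalar A l).
Proof.
move=> [B hB]; exists (sub_scalar B (Num.conj l)) => x y.
by rewrite !sub_scalarE dotBl dotBr hB dotZl dotZr conjCK.
Qed.

Hypothesis dot_norm : induces_norm dot.

(** The images of an orthonormal sequence cluster at some [l], and [l] is almost
    orthogonal to the far terms of the sequence. *)
Lemma compact_small (K : {linear H -> H}) (u : nat -> H) : compact_op K ->
  (forall j, rnorm (u j) = 1) -> (forall i j, i != j -> dot (u i) (u j) = 0) ->
  forall eps : R, 0 < eps -> exists j, rnorm (dot (K (u j)) (u j)) < eps.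
Proof.
move=> cK u1 u0 eps e0; have e2 : 0 < eps / 2 by rewrite divr_gt0.
have [|l hl] := precompact_cluster (u := fun j => K (u j)) cK.
  by move=> n; exists (u n) => //=; rewrite u1.
have [N hN] := orthonormal_small dot_norm u1 u0 l e2.
have [n Nn hn] := hl _ N e2; exists n.
have -> : dot (K (u n)) (u n) = dot (K (u n) - l) (u n) + dot l (u n).
  by rewrite dotBl subrK.
rewrite (le_lt_trans (rnormD _ _))//.
have := hN n Nn; have := cauchy_schwarz dot_norm (K (u n) - l) (u n).
by rewrite u1 mulr1; move: hn; lra.
Qed.

End Operators.

(** * Blocks *)

Section Shift.
Variables (R : realType) (H : completeNormedModType R[i]).
Variable dot : {dot H for @Num.conj R[i]}.
Hypothesis dot_norm : induces_norm dot.
Variable e : nat -> H.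
Hypothesis e_onb : orthonormal_basis dot e.
Implicit Types (u v : H) (l : R[i]).

Lemma dimension_infty_e (V : set H) : (forall M, exists2 n, (M <= n)%N & V (e n)) ->
  dimension V = +oo%E.
Proof.
move=> h; apply: dimension_infty => m.
have /choice[f hf] (M : nat) : exists n, (M <= n)%N /\ V (e n) by have [n] := h M; exists n.
pose z := fix z n := if n is k.+1 then f (z k).+1 else f 0%N.
have zS n : (z n < z n.+1)%N by have [] := hf (z n).+1.
have zV n : V (e (z n)) by case: n => [|n] /=; [have [] := hf 0%N|have [] := hf (z n).+1].
have zinj i j : (i < j)%N -> (z i < z j)%N.
  apply: (@homo_ltn _ z (fun a b => (a < b)%N)) => [m' n p|n]; [exact: ltn_trans|exact: zS].
exists (fun i => e (z i)) => // c /(congr1 (dot ^~ _)) hc i.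
have := hc (e (z i)); rewrite dot0l dot_suml (bigD1 i)//= dotZl (dot_ee e_onb) eqxx mulr1.
rewrite big1 ?addr0// => j ji; rewrite dotZl (dot_ee e_onb).
have -> : (z j == z i) = false; last by rewrite mulr0.
have : (j : nat) != i by [].
by rewrite neq_ltn => /orP[/zinj|/zinj] h'; [rewrite ltn_eqF|rewrite gtn_eqF].
Qed.

Definition block (M N : nat) (u : H) :=
  exists2 c : nat -> R[i], u = fsum e c N & forall k, (k < M)%N -> c k = 0.

Lemma block_orth M N N' u v : block M N u -> block N N' v -> dot u v = 0.
Proof.
move=> [c -> _] [c' -> c'0]; rewrite dot_fsumv big1_seq// => k _.
by rewrite (dot_fsum e_onb); case: ltnP => kN; rewrite ?mulr0// c'0// rmorph0 mul0r.
Qed.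

Lemma block_extend M N N' u a b : block M N u -> (M <= N')%N -> (N <= N')%N ->
  block M N'.+1 (a *: u + b *: e N').
Proof.
move=> [c -> c0] MN' NN'.
exists (fun n => if (n < N)%N then a * c n else if n == N' then b else 0).
  apply: (coord_inj dot_norm e_onb) => n.
  rewrite dotDl !dotZl !(dot_fsum e_onb) (dot_ee e_onb).
  case: (ltnP n N) => nN.
    have nN' := leq_trans nN NN'.
    by rewrite gtn_eqF// mulr0 addr0 leqW.
  rewrite mulr0 add0r eq_sym; case: eqVneq => [->|_]; first by rewrite ltnSn mulr1.
  by rewrite mulr0 if_same.
move=> k kM; case: ifP => _; first by rewrite c0// mulr0.
by rewrite ltn_eqF// (leq_trans kM).
Qed.

Lemma block_normalize (A : {linear H -> H}) M N u (eps : R) : 0 < rnorm u -> block M N u ->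
  rnorm (A u) <= eps * rnorm u ->
  exists v, block M N v /\ (rnorm v = 1 /\ rnorm (A v) <= eps).
Proof.
move=> u0 [c uE c0] h; pose a : R[i] := (rnorm u)^-1%:C.
have an : rnorm a = (rnorm u)^-1 by rewrite rnorm_real ger0_norm// invr_ge0 rnorm_ge0.
exists (a *: u); split; last first.
  rewrite linearZ /= !rnormZ an mulVf ?gt_eqF//; split => //.
  by rewrite mulrC ler_pdivrMr.
exists (fun k => a * c k); last by move=> k /c0 ->; rewrite mulr0.
by rewrite uE /fsum scaler_sumr; apply: eq_bigr => k _; rewrite scalerA.
Qed.

(** Each block is chosen beyond the end of the preceding one. *)
Lemma block_sequence (Q : nat -> H -> Prop) :
  (forall j M, exists N u, [/\ (M <= N)%N, block M N u & Q j u]) ->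
  exists u : nat -> H, [/\ forall j, Q j (u j), forall i j, i != j -> dot (u i) (u j) = 0
    & forall j, exists c N, u j = fsum e c N].
Proof.
move=> h.
have /choice[f hf] (p : nat * nat) : exists q : nat * H,
    [/\ (p.2 <= q.1)%N, block p.2 q.1 q.2 & Q p.1 q.2].
  by have [N [u hu]] := h p.1 p.2; exists (N, u).
pose M := fix M j := if j is k.+1 then (f (k, M k)).1 else 0%N.
pose u j := (f (j, M j)).2.
have bu j : block (M j) (M j.+1) (u j) by have [] := hf (j, M j).
have Mh : {homo M : m n / (m <= n)%N}.
  apply: homo_leq => [m|m n p|j]; [exact: leqnn|exact: leq_trans|].
  by have [] := hf (j, M j).
have lt_orth i j : (i < j)%N -> dot (u i) (u j) = 0.
  move=> ij; have [c' uj c'0] := bu j; apply: (block_orth (bu i)).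
  exists c'; first exact: uj.
  by move=> k kM; apply: c'0; exact: leq_trans kM (Mh _ _ ij).
exists u; split.
- by move=> j; have [] := hf (j, M j).
- move=> i j; rewrite neq_ltn => /orP[/lt_orth//|/lt_orth ji].
  by rewrite dot_conj ji rmorph0.
- by move=> j; have [c -> _] := bu j; exists c, (M j.+1).
Qed.

(** Take orthonormal blocks [u j] with [rnorm (A (u j)) <= 2^-j]. The sum of the
    [A (u j)] converges to some [y] in the closure of the range. If [A z = y], then,
    since each coordinate of a vector is controlled by its image, the coordinates
    of [z] are those of the formal sum of the [u j], so [dot z (u j) = 1] for all
    [j], which contradicts Bessel's inequality. *)
Lemma range_not_closed (A : {linear H -> H}) : continuous A ->
  (forall n, exists C : R, forall v, rnorm (dot v (e n)) <= C * rnorm (A v)) ->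
  (forall (eps : R) M, 0 < eps -> exists N u,
      [/\ (M <= N)%N, block M N u & rnorm u = 1 /\ rnorm (A u) <= eps]) ->
  ~ closed (range A).
Proof.
move=> /linear_bounded_rnormP[K K0 hK] hC hu clA.
have [|u [Qu u0 ub]] := @block_sequence (fun j u => rnorm u = 1 /\ rnorm (A u) <= 2^-1 ^+ j).
  by move=> j M; apply: hu; rewrite exprn_gt0.
have u1 j : rnorm (u j) = 1 by case: (Qu j).
pose Z n := \sum_(0 <= j < n) u j.
have geo m n : rnorm (A (Z (m + n)%N) - A (Z m)) <= 2 * 2^-1 ^+ m - 2 * 2^-1 ^+ (m + n).
  elim: n => [|n IH]; first by rewrite addn0 !subrr rnorm0.
  rewrite addnS /Z big_nat_recr//= -/(Z _) linearD addrAC (le_trans (rnormD _ _))//.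
  have [_ h] := Qu (m + n)%N; move: IH h; rewrite exprS; lra.
have small (eps : R) : 0 < eps -> exists N, forall n, (N <= n)%N -> 2 * 2^-1 ^+ n < eps.
  move=> e0; have e2 : 0 < eps / 2 by rewrite divr_gt0.
  have /cvgrPdist_lt /(_ _ e2) [N _ hN] : (2^-1 : R) ^+ n @[n --> \oo] --> 0.
    by apply: cvg_expr; rewrite ger0_norm// invf_lt1// ltr1n.
  exists N => n /hN /=; rewrite sub0r normrN ger0_norm ?exprn_ge0//; lra.
have pos n : (0 : R) <= 2 * 2^-1 ^+ n by rewrite mulr_ge0// exprn_ge0.
have [y hy] : exists y : H, (A \o Z) @ \oo --> y.
  apply: rnorm_cauchy_cvg => eps /small[N hN]; exists N.
  suff key m n : (N <= m)%N -> (m <= n)%N -> rnorm (A (Z n) - A (Z m)) < eps.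
    move=> m n Nm Nn; have [mn|/ltnW nm] := leqP m n; last exact: key.
    by rewrite rnormC; exact: key.
  move=> Nm mn; rewrite -(subnKC mn) (le_lt_trans (geo _ _))//.
  have := hN m Nm; have := pos (m + (n - m))%N; lra.
have {}hy := (cvg_rnormP _ _).1 hy.
have [z _ Az] : range A y.
  apply: clA; apply/closure_rnormP => eps /hy [N hN].
  by exists (A (Z N)); [exists (Z N)|exact: hN].
have hCf i : exists2 C : R, 0 < C & forall v, rnorm (dot v (u i)) <= C * rnorm (A v).
  have [c [N ->]] := ub i; elim: N => [|N [C C0 IH]].
    by exists 1 => // v; rewrite /fsum big_geq// dot0r rnorm0 mul1r rnorm_ge0.
  have [C' hC'] := hC N; exists (C + rnorm (c N) * `|C'|).
    by rewrite ltr_wpDr// mulr_ge0 ?rnorm_ge0.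
  move=> v; rewrite fsumS dotDr dotZr (le_trans (rnormD _ _))// mulrDl lerD//.
  rewrite rnormM rnorm_Conj -mulrA ler_wpM2l ?rnorm_ge0// (le_trans (hC' v))//.
  by rewrite ler_wpM2r ?rnorm_ge0// ler_norm.
have Zu i n : (i < n)%N -> dot (Z n) (u i) = 1.
  move=> ilt; rewrite dot_suml (bigD1_seq i) ?iota_uniq ?mem_index_iota//=.
  rewrite (dotvv dot_norm) u1 expr1n big1 ?addr0// => j ji.
  exact: u0.
have zu i : dot z (u i) = 1.
  have [C C0 hCi] := hCf i.
  apply/eqP; rewrite -subr_eq0; apply/eqP/rnorm0_eq0/eqP.
  rewrite eq_le rnorm_ge0 andbT; apply/ler_addgt0Pr => eps e0; rewrite add0r.
  have [|N hN] := hy (eps / C); first by rewrite divr_gt0.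
  have := hN (maxn N i.+1) (leq_maxl _ _); rewrite /= -Az -linearB.
  rewrite ltr_pdivlMr// mulrC => h.
  rewrite -(Zu i (maxn N i.+1)) ?leq_maxr// rnormC -dotBl.
  exact: le_trans (hCi _) (ltW h).
have [N /(_ N (leqnn _))] := orthonormal_small dot_norm u1 u0 z (@ltr01 R).
by rewrite zu rnorm1 ltxx.
Qed.

(** Coefficients are indexed from the start [n0] of the window, so that the test
    vectors below have the same formula in every window. *)
Definition bsum (c : nat -> R[i]) n0 m : H := \sum_(0 <= k < m) c k *: e (n0 + k)%N.

Lemma bsumS c n0 m : bsum c n0 m.+1 = bsum c n0 m + c m *: e (n0 + m)%N.
Proof. by rewrite /bsum big_nat_recr. Qed.

Lemma bsum0 c n0 : bsum c n0 0 = 0.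
Proof. by rewrite /bsum big_geq. Qed.

Lemma block_bsum c n0 m : block n0 (n0 + m) (bsum c n0 m).
Proof.
exists (fun n => if (n < n0)%N then 0 else c (n - n0)%N); last by move=> k ->.
rewrite /fsum /bsum [RHS](big_cat_nat (n := n0)) ?leq_addr//=.
rewrite [X in _ = X + _]big1_seq ?add0r; last first.
  by move=> k /=; rewrite mem_index_iota => /andP[_ ->]; rewrite scale0r.
have E F : \sum_(n0 <= k < n0 + m) F k = \sum_(0 <= k < m) F (k + n0)%N :> H.
  by rewrite -{1}(add0n n0) big_addn addKn.
rewrite E; apply: eq_bigr => k _.
by rewrite ltnNge leq_addl /= addnK addnC.
Qed.

Lemma dot_bsum_e c n0 m n : (n0 + m <= n)%N -> dot (bsum c n0 m) (e n) = 0.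
Proof.
have [c' -> _] := block_bsum c n0 m => h.
by rewrite (dot_fsum e_onb) ltnNge h.
Qed.

Lemma rnorm_bsum c n0 m : rnorm (bsum c n0 m) ^+ 2 = \sum_(0 <= k < m) rnorm (c k) ^+ 2.
Proof.
elim: m => [|m IH]; first by rewrite bsum0 big_geq// rnorm0 expr0n.
rewrite bsumS (pythagoras dot_norm); last by rewrite dotZr dot_bsum_e ?mulr0.
by rewrite IH big_nat_recr//= rnormZ (rnorm_e dot_norm e_onb) mulr1.
Qed.

Lemma dot_bsum c c' n0 m :
  dot (bsum c n0 m) (bsum c' n0 m) = \sum_(0 <= k < m) c k * Num.conj (c' k).
Proof.
elim: m => [|m IH]; first by rewrite bsum0 dot0l big_geq.
rewrite !bsumS big_nat_recr//= !dotDl !dotDr !dotZl !dotZr IH dot_bsum_e//.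
rewrite [dot (e _) (bsum _ _ _)]dot_conj dot_bsum_e// rmorph0 (dot_ee e_onb) eqxx.
by rewrite mulr1n; ring.
Qed.

Lemma bsum_recl c n0 m : bsum c n0 m.+1 = c 0%N *: e n0 + bsum (fun k => c k.+1) n0.+1 m.
Proof.
rewrite /bsum big_nat_recl// addn0; congr (_ + _); apply: eq_bigr => k _.
by rewrite addSnnS.
Qed.

Lemma bsumB c c' n0 m : bsum c n0 m - bsum c' n0 m = bsum (fun k => c k - c' k) n0 m.
Proof. by rewrite /bsum -sumrB; apply: eq_bigr => k _; rewrite scalerBl. Qed.

Lemma bsumZ a c n0 m : a *: bsum c n0 m = bsum (fun k => a * c k) n0 m.
Proof. by rewrite /bsum scaler_sumr; apply: eq_bigr => k _; rewrite scalerA. Qed.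

(** * Weighted shifts *)

Variables (x : nat -> R) (T : {linear H -> H}) (rmin rmax : R).
Hypothesis T_cont : continuous T.
Hypothesis T_shift : forall n, T (e n) = (x n)%:C *: e n.+1.
Hypothesis rmin_ge0 : 0 <= rmin.
Hypothesis rmax_gt0 : 0 < rmax.
Hypothesis x_bnd : forall n, rmin <= x n <= rmax.

Let x_ge0 n : 0 <= x n.
Proof. by have /andP[h _] := x_bnd n; exact: le_trans h. Qed.

Let x_sq n : rmin ^+ 2 <= x n ^+ 2 <= rmax ^+ 2.
Proof.
have /andP[h1 h2] := x_bnd n; have r0 := ltW rmax_gt0.
by rewrite !ler_sqr ?nnegrE// h1 h2.
Qed.

Lemma T_cvg (u : nat -> H) v : u @ \oo --> v -> (T \o u) @ \oo --> T v.
Proof. by move=> uv; apply: continuous_cvg => //; exact: T_cont. Qed.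

Definition shift_seq (c : nat -> R[i]) n : R[i] :=
  if n is k.+1 then (x k)%:C * c k else 0.

Lemma T_fsum c N : T (fsum e c N) = fsum e (shift_seq c) N.+1.
Proof.
elim: N => [|N IH].
  by rewrite /fsum big_geq// big_nat1 /= scale0r linear0.
by rewrite fsumS linearD linearZ /= T_shift IH [in RHS]fsumS /= scalerA mulrC.
Qed.

(** By continuity of [T] and density of the finite sums. *)
Lemma T_coord v n : dot (T v) (e n) = shift_seq (fun k => dot v (e k)) n.
Proof.
have := T_cvg (@fsum_cvg _ _ _ _ e_onb v) => h.
apply: (dot_cvg_const dot_norm (N0 := n) h) => m nm.
by rewrite /= T_fsum (dot_fsum e_onb) ltnS nm.
Qed.

Lemma T_coord0 v : dot (T v) (e 0%N) = 0.
Proof. by rewrite T_coord. Qed.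

Lemma T_coordS v n : dot (T v) (e n.+1) = (x n)%:C * dot v (e n).
Proof. by rewrite T_coord. Qed.

Lemma sum_T_coord v N : \sum_(0 <= k < N.+1) rnorm (dot (T v) (e k)) ^+ 2 =
  \sum_(0 <= k < N) (x k * rnorm (dot v (e k))) ^+ 2.
Proof.
rewrite big_nat_recl// T_coord0 rnorm0 expr0n add0r; apply: eq_bigr => k _.
by rewrite T_coordS rnormM rnorm_real ger0_norm.
Qed.

Lemma T_rnorm_le v : rnorm (T v) <= rmax * rnorm v.
Proof.
apply: (parseval_le dot_norm e_onb); first by rewrite mulr_ge0 ?rnorm_ge0// ltW.
case=> [|N]; first by rewrite big_geq// sqr_ge0.
rewrite sum_T_coord (@le_trans _ _ (rmax ^+ 2 * \sum_(0 <= k < N) rnorm (dot v (e k)) ^+ 2))//.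
  rewrite mulr_sumr ler_sum// => k _; rewrite exprMn ler_wpM2r ?sqr_ge0//.
  by case/andP: (x_sq k).
by rewrite exprMn ler_wpM2l ?sqr_ge0//; exact: bessel.
Qed.

Lemma T_rnorm_ge v : rmin * rnorm v <= rnorm (T v).
Proof.
have [->|r0] := eqVneq rmin 0; first by rewrite mul0r rnorm_ge0.
have r0' : 0 < rmin by rewrite lt_def r0.
rewrite mulrC -ler_pdivlMr//; apply: (parseval_le dot_norm e_onb).
  by rewrite divr_ge0 ?rnorm_ge0.
move=> N; rewrite exprMn exprVn ler_pdivlMr ?exprn_gt0//.
apply: le_trans (bessel dot_norm e_onb (T v) N.+1); rewrite sum_T_coord.
rewrite mulrC mulr_sumr ler_sum// => k _; rewrite exprMn ler_wpM2r ?sqr_ge0//.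
by case/andP: (x_sq k).
Qed.

Lemma sub_scalar_ge_outer l v : (rnorm l - rmax) * rnorm v <= rnorm (sub_scalar T l v).
Proof.
rewrite sub_scalarE rnormC (le_trans _ (rnormB_ge _ _))// rnormZ mulrBl lerB//.
exact: T_rnorm_le.
Qed.

Lemma sub_scalar_ge_inner l v : (rmin - rnorm l) * rnorm v <= rnorm (sub_scalar T l v).
Proof.
rewrite sub_scalarE (le_trans _ (rnormB_ge _ _))// rnormZ mulrBl lerB//.
exact: T_rnorm_ge.
Qed.

Lemma bounded_below_off_annulus l : ~ annulus0 rmin rmax l -> bounded_below (sub_scalar T l).
Proof.
rewrite /annulus0 /= => /negP; rewrite negb_and -!ltNge => /orP[h|h].
  by exists (rmin - rnorm l); rewrite ?subr_gt0// => v; exact: sub_scalar_ge_inner.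
by exists (rnorm l - rmax); rewrite ?subr_gt0// => v; exact: sub_scalar_ge_outer.
Qed.

Lemma sub_scalar_coord0 l v : dot (sub_scalar T l v) (e 0%N) = - l * dot v (e 0%N).
Proof. by rewrite sub_scalarE dotBl dotZl T_coord0 sub0r mulNr. Qed.

Lemma sub_scalar_coordS l v n : dot (sub_scalar T l v) (e n.+1) =
  (x n)%:C * dot v (e n) - l * dot v (e n.+1).
Proof. by rewrite sub_scalarE dotBl dotZl T_coordS. Qed.

Lemma sub_scalar_cont l : continuous (sub_scalar T l).
Proof.
apply/linear_bounded_rnormP; exists (rmax + rnorm l).
  by rewrite ltr_wpDr ?rnorm_ge0.
move=> v; rewrite sub_scalarE (le_trans (rnormD _ _))// rnormN rnormZ mulrDl lerD2r.
exact: T_rnorm_le.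
Qed.

(** The equation is solved coordinate by coordinate. The truncations [s N] of the
    solution satisfy [s N.+1 = l^-1 (T (s N) - y_N.+1)], and [T / l] is a strict
    contraction, so they stay bounded and [riesz_fischer] applies. *)
Lemma surjective_outside l : rmax < rnorm l -> surjective_op (sub_scalar T l).
Proof.
move=> hl; apply/seteqP; split => // y _.
have l_gt0 : 0 < rnorm l := lt_trans rmax_gt0 hl.
have l0 : l != 0 by apply: contraTneq l_gt0 => ->; rewrite rnorm0 ltxx.
pose z := fix z n : R[i] := if n is k.+1 then ((x k)%:C * z k - dot y (e k.+1)) / l
                   else - dot y (e 0%N) / l.
pose yc n := dot y (e n).
have zE N : fsum e z N.+1 = l^-1 *: (T (fsum e z N) - fsum e yc N.+1).
  elim: N => [|N IH].
    rewrite /fsum !big_nat1 big_geq// linear0 sub0r scalerN scalerA /= -scaleNr.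
    by congr (_ *: _); rewrite /yc; ring.
  rewrite [LHS]fsumS [in LHS]IH [fsum e z N.+1]fsumS [fsum e yc N.+2]fsumS.
  rewrite [T (_ + _)]linearD opprD addrACA [RHS]scalerDr; congr (_ + _).
  rewrite linearZ /= T_shift scalerA -scalerBl scalerA; congr (_ *: _).
  by rewrite /yc; ring.
pose q := rmax / rnorm l.
have q1 : 0 < 1 - q by rewrite subr_gt0 ltr_pdivrMr// mul1r.
pose C := rnorm y / rnorm l / (1 - q).
have C0 : 0 <= C by rewrite !divr_ge0// ?rnorm_ge0// ltW.
have hz N : rnorm (fsum e z N) <= C.
  elim: N => [|N IH]; first by rewrite /fsum big_geq// rnorm0.
  rewrite zE rnormZ rnormV.
  have h1 : rnorm (T (fsum e z N) - fsum e yc N.+1) <= rmax * C + rnorm y.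
    rewrite (le_trans (rnormD _ _))// rnormN lerD//.
      by rewrite (le_trans (T_rnorm_le _))// ler_wpM2l// ltW.
    rewrite -ler_sqr ?nnegrE ?rnorm_ge0// (rnorm_fsum dot_norm e_onb).
    exact: bessel.
  rewrite mulrC ler_pdivrMr//; apply: le_trans h1 _.
  rewrite le_eqVlt; apply/orP; left; apply/eqP.
  have CE : C * (1 - q) = rnorm y / rnorm l by rewrite mulfVK// gt_eqF.
  have -> : rnorm y = C * (1 - q) * rnorm l by rewrite CE mulfVK// gt_eqF.
  have -> : rmax = q * rnorm l by rewrite mulfVK// gt_eqF.
  by ring.
have [v hv] := riesz_fischer dot_norm e_onb hz.
exists v => //; apply: (coord_inj dot_norm e_onb) => -[|n].
  by rewrite sub_scalar_coord0 hv /=; field.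
by rewrite sub_scalar_coordS !hv /=; field.
Qed.

Lemma T_bsum c n0 m : T (bsum c n0 m) = bsum (fun k => (x (n0 + k)%N)%:C * c k) n0.+1 m.
Proof.
elim: m => [|m IH]; first by rewrite !bsum0 linear0.
by rewrite !bsumS linearD IH linearZ /= T_shift scalerA mulrC addSn.
Qed.

(** The adjoint is the backward weighted shift, defined by its coordinates through
    [riesz_fischer]. *)
Lemma shift_has_adjoint : has_adjoint dot T.
Proof.
have /choice[B hB] y : exists z, forall n, dot z (e n) = (x n)%:C * dot y (e n.+1).
  apply: (riesz_fischer dot_norm e_onb (C := rmax * rnorm y)) => N.
  have r0 := ltW rmax_gt0.
  rewrite -ler_sqr ?nnegrE ?mulr_ge0 ?rnorm_ge0// (rnorm_fsum dot_norm e_onb).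
  rewrite (@le_trans _ _ (rmax ^+ 2 * \sum_(0 <= k < N) rnorm (dot y (e k.+1)) ^+ 2))//.
    rewrite mulr_sumr ler_sum// => k _; rewrite rnormM exprMn rnorm_real ler_wpM2r ?sqr_ge0//.
    by rewrite real_normK ?num_real//; case/andP: (x_sq k).
  rewrite exprMn ler_wpM2l ?sqr_ge0//.
  rewrite (le_trans _ (bessel dot_norm e_onb y N.+1))// big_nat_recl//.
  by rewrite lerDr sqr_ge0.
have Blin : linear B.
  move=> a u v; apply: (coord_inj dot_norm e_onb) => n.
  by rewrite hB !dotDl !dotZl !hB; ring.
pose BL : {linear H -> H} := HB.pack B (GRing.isLinear.Build _ _ _ _ B Blin).
exists BL => u y; rewrite /=.
have hf N : dot (fsum e (shift_seq (fun k => dot u (e k))) N.+1) y =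
            dot (fsum e (fun k => dot u (e k)) N) (B y).
  elim: N => [|N IH]; first by rewrite /fsum big_nat1 big_geq//= scale0r !dot0l.
  rewrite [in LHS]fsumS [in RHS]fsumS !dotDl IH !dotZl; congr (_ + _).
  rewrite [dot (e N) _]dot_conj hB rmorphM /= -dot_conj [Num.conj _]conjc_real.
  by ring.
have /(_ y) cv1 := dot_cvg dot_norm (T_cvg (@fsum_cvg _ _ _ _ e_onb u)).
have /(_ (B y)) cv2 := dot_cvg dot_norm (@fsum_cvg _ _ _ _ e_onb u).
apply/eqP; rewrite -subr_eq0; apply/eqP/rnorm0_eq0/eqP.
rewrite eq_le rnorm_ge0 andbT; apply/ler_addgt0Pr => eps e0; rewrite add0r.
have e2 : 0 < eps / 2 by rewrite divr_gt0.
have [N1 h1] := cv1 _ e2; have [N2 h2] := cv2 _ e2.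
have := h1 (maxn N1 N2) (leq_maxl _ _); have := h2 (maxn N1 N2) (leq_maxr _ _).
rewrite /= T_fsum hf => {}h2 {}h1.
apply: le_trans (rnorm_tri _ (dot (fsum e (fun k => dot u (e k)) (maxn N1 N2)) (B y)) _) _.
by rewrite rnormC; move: h1 h2; lra.
Qed.

Let has_adj l := has_adjoint_sub l shift_has_adjoint.

(** The eigenvectors of the adjoint, in coordinates; see [adjoint_eigenP] and
    [ker_adjoint_sub]. *)
Definition adj_eigen l : set H :=
  [set v | forall n, (x n)%:C * dot v (e n.+1) = l * dot v (e n)].

Lemma adjoint_coordE v n :
  dot (adjoint dot T v) (e n) = (x n)%:C * dot v (e n.+1).
Proof.
rewrite (adjoint_dotE _ _ shift_has_adjoint) T_shift dotZl rmorphM /= -dot_conj.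
by rewrite [Num.conj _]conjc_real.
Qed.

Lemma adjoint_eigenP l v : adjoint dot T v = l *: v <-> adj_eigen l v.
Proof.
split=> [h n|h]; first by rewrite -adjoint_coordE h dotZl.
by apply: (coord_inj dot_norm e_onb) => n; rewrite adjoint_coordE dotZl h.
Qed.

Lemma ker_adjoint_sub l : op_ker (adjoint dot (sub_scalar T l)) = adj_eigen (Num.conj l).
Proof.
have E v n : dot (adjoint dot (sub_scalar T l) v) (e n) =
    (x n)%:C * dot v (e n.+1) - Num.conj l * dot v (e n).
  rewrite (adjoint_dotE _ _ (has_adj l)) sub_scalarE T_shift dotBl !dotZl.
  rewrite rmorphB !rmorphM /= -!dot_conj.
  by rewrite [Num.conj _%:C]conjc_real.
apply/seteqP; split => v /=.
  by move=> h n; apply/eqP; rewrite -subr_eq0 -E h dot0l.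
move=> h; apply: (coord_inj dot_norm e_onb) => n.
by rewrite E h subrr dot0l.
Qed.

Lemma ker_sub_adjoint l : op_ker (sub_scalar (adjoint dot T) l) = adj_eigen l.
Proof.
apply/seteqP; split => v; rewrite /op_ker /mkset sub_scalarE.
  by move/subr0_eq; rewrite adjoint_eigenP.
by move/adjoint_eigenP => ->; rewrite subrr.
Qed.

Lemma adj_point_spectrumE : point_spectrum (adjoint dot T) =
  [set l | exists2 v, v != 0 & adj_eigen l v].
Proof.
by apply/seteqP; split => l [v v0 h]; exists v => //; apply/adjoint_eigenP.
Qed.

(** The kernel of the adjoint is orthogonal to the range. *)
Lemma surjective_ker_adjoint l : surjective_op (sub_scalar T l) ->
  adj_eigen (Num.conj l) = [set 0].
Proof.
move=> sT; rewrite -ker_adjoint_sub; apply/seteqP; split => v; rewrite /op_ker /mkset; last first.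
  by move=> ->; rewrite linear0.
move=> h; have [z _ zv] : range (sub_scalar T l) v by rewrite sT.
have := adjointP (has_adj l) z v; rewrite zv h dot0r => /eqP.
by rewrite dnorm_eq0 => /eqP.
Qed.

(** The first coordinate of an eigenvector vanishes, and then all the others. *)
Lemma T_eigen0 l v : l != 0 -> T v = l *: v -> v = 0.
Proof.
move=> l0 h; apply: (coord_inj dot_norm e_onb) => n; rewrite dot0l.
have c m : dot (T v) (e m) = l * dot v (e m) by rewrite h dotZl.
elim: n => [|n IH]; [have := c 0%N|have := c n.+1].
  by rewrite T_coord0 => /esym/eqP; rewrite mulf_eq0 (negPf l0) => /eqP.
by rewrite T_coordS IH mulr0 => /esym/eqP; rewrite mulf_eq0 (negPf l0) => /eqP.
Qed.

Lemma T_injective_pos v : (forall n, 0 < x n) -> T v = 0 -> v = 0.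
Proof.
move=> x0 h; apply: (coord_inj dot_norm e_onb) => n; rewrite dot0l.
have := T_coordS v n; rewrite h dot0l => /esym/eqP; rewrite mulf_eq0 => /orP[|/eqP//].
by move=> /eqP[] h0; have := x0 n; rewrite h0 ltxx.
Qed.

Lemma point_spectrum_pos : (forall n, 0 < x n) -> point_spectrum T = set0.
Proof.
move=> x0; apply/seteqP; split => // l [v /eqP v0 h]; apply: v0.
have [l0|l0] := eqVneq l 0; last exact: T_eigen0 h.
by apply: T_injective_pos => //; rewrite h l0 scale0r.
Qed.

Definition wprod n : R := \prod_(0 <= k < n) x k.

Lemma wprodS n : wprod n.+1 = wprod n * x n.
Proof. by rewrite /wprod big_nat_recr. Qed.

Lemma wprod0 : wprod 0 = 1.
Proof. by rewrite /wprod big_geq. Qed.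

Lemma wprod_gt0 n : (forall n, 0 < x n) -> 0 < wprod n.
Proof. by move=> x0; elim: n => [|n IH]; rewrite ?wprod0// wprodS mulr_gt0. Qed.

(** Hence the first coordinate determines an eigenvector of the adjoint when no
    weight vanishes. *)
Lemma adj_eigen_coord l v n : adj_eigen l v ->
  (wprod n)%:C * dot v (e n) = l ^+ n * dot v (e 0%N).
Proof.
move=> h; elim: n => [|n IH]; first by rewrite wprod0 expr0.
rewrite wprodS rmorphM /= -mulrA h mulrCA IH exprS.
by ring.
Qed.

Lemma adj_eigen_coord0 l v : (forall n, 0 < x n) -> adj_eigen l v -> v != 0 -> dot v (e 0%N) != 0.
Proof.
move=> x0 h; apply: contraNneq => v0; apply/eqP; apply: (coord_inj dot_norm e_onb) => n.
have := adj_eigen_coord n h; rewrite v0 mulr0 dot0l => /eqP; rewrite mulf_eq0 => /orP[|/eqP//].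
by move=> /eqP[] w0; have := wprod_gt0 n x0; rewrite w0 ltxx.
Qed.

Lemma dimension_adj_eigen l v : (forall n, 0 < x n) -> adj_eigen l v -> v != 0 ->
  dimension (adj_eigen l) = 1%:E.
Proof.
move=> x0 h v0; have v00 := adj_eigen_coord0 x0 h v0.
apply: (dimension1 v0); apply/seteqP; split => [u hu|_ [a _ <-] n]; last first.
  by rewrite !dotZl mulrCA h mulrCA.
exists (dot u (e 0%N) / dot v (e 0%N)) => //.
apply: (coord_inj dot_norm e_onb) => n; rewrite dotZl.
have w0 : (wprod n)%:C != 0 :> R[i].
  by apply/eqP => -[] w0; have := wprod_gt0 n x0; rewrite w0 ltxx.
apply: (mulfI w0); rewrite mulrCA (adj_eigen_coord n h) (adj_eigen_coord n hu).
by field.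
Qed.

(** The formal eigenvector has coordinates [l ^+ n / wprod n], dominated here by a
    geometric sequence. *)
Lemma adj_eigen_exists l (C q : R) : (forall n, 0 < x n) -> 0 <= q < 1 ->
  (forall n, rnorm l ^+ n <= C * q ^+ n * wprod n) ->
  exists2 v, v != 0 & adj_eigen l v.
Proof.
move=> x0 /andP[q0 q1] h.
have w0 n : (wprod n)%:C != 0 :> R[i].
  by apply/eqP => -[] w0; have := wprod_gt0 n x0; rewrite w0 ltxx.
pose c n : R[i] := l ^+ n / (wprod n)%:C.
have cb k : rnorm (c k) <= C * q ^+ k.
  rewrite /c rnormM rnormV rnormX rnorm_real gtr0_norm ?wprod_gt0//.
  by rewrite ler_pdivrMr ?wprod_gt0.
have C0 : 0 <= C by have := cb 0%N; rewrite expr0 mulr1; apply: le_trans; exact: rnorm_ge0.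
have q1' : 0 < 1 - q by rewrite subr_gt0.
have cN N : rnorm (fsum e c N) <= C / (1 - q).
  suff : rnorm (fsum e c N) <= C * (1 - q ^+ N) / (1 - q).
    move=> /le_trans; apply; rewrite ler_pM2r ?invr_gt0// -[leRHS]mulr1 ler_wpM2l//.
    by rewrite gerBl exprn_ge0.
  elim: N => [|N IH]; first by rewrite /fsum big_geq// rnorm0 expr0 subrr mulr0 mul0r.
  rewrite fsumS (le_trans (rnormD _ _))// rnormZ (rnorm_e dot_norm e_onb) mulr1.
  rewrite (le_trans (lerD IH (cb N)))// le_eqVlt; apply/orP; left; apply/eqP.
  by rewrite exprS; field; rewrite gt_eqF.
have [v hv] := riesz_fischer dot_norm e_onb cN.
exists v.
  apply: contraTneq (oner_neq0 R[i]) => v0; rewrite negbK.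
  by have := hv 0%N; rewrite v0 dot0l /c wprod0 expr0 divr1 => /esym ->.
move=> n; have xn0 : (x n)%:C != 0 :> R[i].
  by apply/eqP => -[] xn; have := x0 n; rewrite xn ltxx.
by rewrite !hv /c wprodS rmorphM /= exprS; field; rewrite ?w0 ?xn0.
Qed.

Lemma x_gt0_of_rmin : 0 < rmin -> forall n, 0 < x n.
Proof. by move=> r0 n; apply: (lt_le_trans r0); case/andP: (x_bnd n). Qed.

Lemma adj_eigen_inner l : rnorm l < rmin -> exists2 v, v != 0 & adj_eigen l v.
Proof.
move=> lr; have rmin0 : 0 < rmin by exact: le_lt_trans (rnorm_ge0 _) lr.
apply: (@adj_eigen_exists l 1 (rnorm l / rmin)).
- exact: x_gt0_of_rmin.
- by rewrite divr_ge0 ?rnorm_ge0//= ltr_pdivrMr// mul1r.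
move=> n; rewrite mul1r; elim: n => [|n IH]; first by rewrite !expr0 wprod0 mulr1.
rewrite !exprS wprodS.
have -> : rnorm l / rmin * (rnorm l / rmin) ^+ n * (wprod n * x n) =
   (rnorm l * (x n / rmin)) * ((rnorm l / rmin) ^+ n * wprod n) by ring.
apply: ler_pM => //; rewrite ?exprn_ge0 ?rnorm_ge0//.
rewrite ler_peMr ?rnorm_ge0// ler_pdivlMr// mul1r.
by case/andP: (x_bnd n).
Qed.

Lemma index_inner l : rnorm l < rmin ->
  dimension (op_ker (sub_scalar T l)) = 0%:E /\
  dimension (op_ker (adjoint dot (sub_scalar T l))) = 1%:E.
Proof.
move=> lr; have rmin0 : 0 < rmin by exact: le_lt_trans (rnorm_ge0 _) lr.
split.
  apply/dimension0/ker_bounded_below/bounded_below_off_annulus.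
  by rewrite /annulus0 /= => /andP[]; rewrite leNgt lr.
have [|v v0 hv] := @adj_eigen_inner (Num.conj l); first by rewrite rnorm_Conj.
by rewrite ker_adjoint_sub (dimension_adj_eigen _ hv)//; exact: x_gt0_of_rmin.
Qed.

Lemma op_index_inner l : odisc0 rmin l -> op_index dot (sub_scalar T l) = (-1)%:E.
Proof. by rewrite /op_index => /index_inner[-> ->]. Qed.

Lemma fredholm_off_annulus l : ~ annulus0 rmin rmax l -> fredholm dot (sub_scalar T l).
Proof.
move=> nA; have bA := bounded_below_off_annulus nA.
split; first by apply: bounded_below_closed_range bA; exact: sub_scalar_cont.
  by rewrite (dimension0 (ker_bounded_below bA)).
have [lr|rl] := ltP (rnorm l) rmin; first by have [_ ->] := index_inner lr.
have lR : rmax < rnorm l by rewrite ltNge; apply/negP => lR; apply: nA; rewrite /annulus0 /= rl.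
by rewrite ker_adjoint_sub (dimension0 (surjective_ker_adjoint (surjective_outside lR))).
Qed.

Definition zeros_io := forall M, exists2 n, (M <= n)%N & x n = 0.

Lemma ker_infty : zeros_io -> dimension (op_ker T) = +oo%E.
Proof.
move=> z; apply: dimension_infty_e => M; have [n Mn xn] := z M; exists n => //.
by rewrite /op_ker /mkset T_shift xn scale0r.
Qed.

Lemma adj_eigen0_infty : zeros_io -> dimension (adj_eigen 0) = +oo%E.
Proof.
move=> z; apply: dimension_infty_e => M; have [n Mn xn] := z M.
exists n.+1; first exact: leqW.
move=> k; rewrite mul0r (dot_ee e_onb); have [[<-]|_] := eqVneq n.+1 k.+1; last by rewrite mulr0.
by rewrite xn mul0r.
Qed.

(** Infinitely many zero weights cut [T] into finite nilpotent shifts. *)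
Lemma point_spectra_zeros : zeros_io ->
  [/\ point_spectrum T = [set 0], point_spectrum (adjoint dot T) = [set 0],
      dimension (op_ker T) = +oo%E & dimension (op_ker (adjoint dot T)) = +oo%E].
Proof.
move=> z; split; last 2 first.
- exact: ker_infty.
- by rewrite -op_ker_sub0 ker_sub_adjoint adj_eigen0_infty.
- apply/seteqP; split => l.
    move=> [v /eqP v0 h]; apply: contrapT => /eqP l0; apply: v0; exact: T_eigen0 h.
  move=> ->; have [n _ xn] := z 0%N; exists (e n); first exact: (e_neq0 dot_norm e_onb).
  by rewrite T_shift xn !scale0r.
rewrite adj_point_spectrumE; apply/seteqP; split => l; last first.
  move=> ->; have [n _ xn] := z 0%N; exists (e n.+1); first exact: (e_neq0 dot_norm e_onb).
  move=> k; rewrite mul0r (dot_ee e_onb); have [[<-]|_] := eqVneq n.+1 k.+1; last by rewrite mulr0.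
  by rewrite xn mul0r.
move=> [v /eqP v0 h]; apply: contrapT => /eqP l0; apply: v0.
apply: (coord_inj dot_norm e_onb) => n; rewrite dot0l.
have [m nm xm] := z n; rewrite -(subKn nm); elim: (m - n)%N => [|k IH].
  have := h m; rewrite subn0 xm mul0r => /esym/eqP; rewrite mulf_eq0 (negPf l0) => /eqP.
  exact.
have [km|mk] := ltnP k m; last first.
  by rewrite (eqP (leqW mk : (m - k.+1 == 0)%N)) -(eqP (mk : (m - k == 0)%N)).
have := h (m - k.+1)%N; rewrite subnSK// IH mulr0 => /esym/eqP.
by rewrite mulf_eq0 (negPf l0) => /eqP.
Qed.

(** The hypotheses on [E] say that [q ^+ n / wprod n] is dominated by a geometric
    sequence when [q < expeR E] and does not tend to zero when [expeR E <= q]. *)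
Lemma point_spectra_pos (E : \bar R) : (forall n, 0 < x n) ->
  (forall q, 0 <= q -> (q%:E < expeR E)%E -> exists C q' : R, 0 <= q' < 1 /\
     forall n, q ^+ n <= C * q' ^+ n * wprod n) ->
  (forall q, 0 < q -> (expeR E <= q%:E)%E ->
     ~ forall eps, 0 < eps -> exists N, forall n, (N <= n)%N -> q ^+ n <= eps * wprod n) ->
  [/\ point_spectrum T = set0,
      point_spectrum (adjoint dot T) = [set 0] `|` [set l | ((rnorm l)%:E < expeR E)%E]
    & forall l, point_spectrum (adjoint dot T) l ->
        dimension (op_ker (sub_scalar (adjoint dot T) l)) = 1%:E].
Proof.
move=> x0 S1 S2; split; first exact: point_spectrum_pos.
  rewrite adj_point_spectrumE; apply/seteqP; split => l.
    move=> [v v0 h]; have [l0|l0] := eqVneq l 0; [by left|right].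
    rewrite /mkset ltNge; apply/negP => El; apply: (S2 _ (rnorm_gt0 l0) El) => eps e0.
    have v00 := rnorm_gt0 (adj_eigen_coord0 x0 h v0).
    have e_orth i j : i != j -> dot (e i) (e j) = 0 by move=> ij; rewrite (dot_ee e_onb) (negPf ij).
    have [N hN] := orthonormal_small dot_norm (rnorm_e dot_norm e_onb) e_orth v (mulr_gt0 e0 v00).
    exists N => n /hN hn.
    rewrite -(ler_pM2r v00) -rnormX -rnormM -(adj_eigen_coord n h) rnormM rnorm_real.
    rewrite gtr0_norm ?wprod_gt0// mulrAC mulrC ler_wpM2r ?ltW// wprod_gt0//.
  case=> [->|h]; last first.
    have [C [q' [q1 hC]]] := S1 _ (rnorm_ge0 l) h; exact: adj_eigen_exists hC.
  apply: (@adj_eigen_exists 0 1 0) => //; first by rewrite lexx ltr01.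
  by move=> [|n]; rewrite rnorm0 ?wprod0 ?expr0 ?mulr1// !expr0n mulr0 mul0r.
move=> l; rewrite adj_point_spectrumE => -[v v0 h].
by rewrite ker_sub_adjoint (dimension_adj_eigen x0 h v0).
Qed.

(** A point of modulus [rmax] would be an equality case of the Cauchy-Schwarz
    inequality, hence an eigenvalue. *)
Lemma num_range_sub z : num_range dot T z -> rnorm z < rmax.
Proof.
move=> [v v1 <-]; rewrite lt_neqAle; apply/andP; split; last first.
  rewrite (le_trans (cauchy_schwarz dot_norm _ _))// v1 mulr1.
  by rewrite (le_trans (T_rnorm_le _))// v1 mulr1.
apply/eqP => zR.
have : rnorm (T v - dot (T v) v *: v) ^+ 2 <= 0.
  rewrite (rnorm_sub_proj dot_norm)// zR subr_le0 ler_sqr ?nnegrE ?rnorm_ge0 ?(ltW rmax_gt0)//.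
  by rewrite (le_trans (T_rnorm_le _))// v1 mulr1.
rewrite real_exprn_even_le0 ?num_real//= => /eqP/rnorm0_eq0/subr0_eq hT.
have z0 : dot (T v) v != 0.
  apply/eqP => z0; have : rnorm (dot (T v) v) = 0 by rewrite z0; exact: rnorm0.
  by rewrite zR => h; move: rmax_gt0; rewrite h ltxx.
have := T_eigen0 z0 hT => v0; move: v1; rewrite /= v0 rnorm0 => /esym/eqP.
by rewrite oner_eq0.
Qed.

(** The coordinates of [v] are computed from those of its image by a triangular
    recursion. *)
Lemma sub_scalar_coord_bound l : (l != 0 \/ forall n, 0 < x n) ->
  forall n, exists C : R, forall v, rnorm (dot v (e n)) <= C * rnorm (sub_scalar T l v).
Proof.
have cs v n : rnorm (dot (sub_scalar T l v) (e n)) <= rnorm (sub_scalar T l v).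
  by rewrite (le_trans (cauchy_schwarz dot_norm _ _))// (rnorm_e dot_norm e_onb) mulr1.
have [l0|l0] := eqVneq l 0; last first.
  move=> _; have lp := rnorm_gt0 l0; elim=> [|n [C hC]].
    exists (rnorm l)^-1 => v; rewrite ler_pdivlMl// -rnormM (le_trans _ (cs v 0%N))//.
    by rewrite sub_scalar_coord0 mulNr rnormN.
  exists ((rnorm l)^-1 * (rmax * C + 1)) => v.
  rewrite -mulrA ler_pdivlMl// -rnormM.
  have -> : l * dot v (e n.+1) = (x n)%:C * dot v (e n) - dot (sub_scalar T l v) (e n.+1).
    by rewrite sub_scalar_coordS; ring.
  rewrite (le_trans (rnormD _ _))// rnormN mulrDl mul1r lerD//.
  rewrite rnormM rnorm_real ger0_norm// -mulrA ler_pM ?rnorm_ge0//.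
  by case/andP: (x_bnd n).
rewrite l0 in cs *; move=> [/eqP//|x0 n].
exists (x n)^-1 => v.
rewrite ler_pdivlMl// (le_trans _ (cs v n.+1))// sub_scalarE scale0r subr0 T_coordS.
by rewrite rnormM rnorm_real ger0_norm.
Qed.

(** * Weighted shifts with extremal windows *)

Hypothesis x_windows : forall (N M : nat) (eps : R), 0 < eps ->
  exists2 n0, (M <= n0)%N & forall k, (k < N + N)%N ->
    `|x (n0 + k)%N - (if (k < N)%N then rmax else rmin)| < eps.

(** In a window where the weights are first close to [rmax] and then close to
    [rmin], the recursion [x_k c_k = l c_(k+1)] of the eigenvectors gives
    coefficients whose absolute values increase up to the middle of the window and
    decrease after it. Hence the first and the last coefficient, which carry the
    error made by truncating to the window, are at most the norm of the vector
    divided by the square root of half the length of the window. *)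
Lemma approx_eigenvector l : annulus0 rmin rmax l -> forall (eps : R) M, 0 < eps ->
  exists N u, [/\ (M <= N)%N, block M N u & rnorm u = 1 /\ rnorm (sub_scalar T l u) <= eps].
Proof.
rewrite /annulus0 /mkset => /andP[l1 l2] eps M e0.
have [l0|l0] := eqVneq l 0.
  move: l1; rewrite l0 rnorm0 => r0; have {r0} r0 : rmin = 0 by apply/eqP; rewrite eq_le r0.
  have [n0 Mn0 /(_ 1%N (ltnSn _))] := x_windows 1 M e0; rewrite /= r0 subr0 => h.
  have [c eE c0] := block_bsum (fun=> 1) (n0 + 1) 1.
  have E : bsum (fun=> 1) (n0 + 1) 1 = e (n0 + 1)%N by rewrite bsumS bsum0 add0r addn0 scale1r.
  exists (n0 + 1 + 1)%N, (e (n0 + 1)%N); split; first by rewrite -addnA (leq_trans Mn0)// leq_addr.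
    exists c; first by rewrite -E.
    by move=> k kM; apply: c0; rewrite (leq_trans kM)// (leq_trans Mn0)// leq_addr.
  rewrite (rnorm_e dot_norm e_onb); split => //.
  rewrite scale0r subr0 T_shift rnormZ (rnorm_e dot_norm e_onb) mulr1.
  by rewrite rnorm_real ltW.
have lp := rnorm_gt0 l0.
(* the boundary errors are at most rmax / sqrt (N + 1) times the norm *)
have [N hN] : exists N : nat, (rmax / (eps / 3)) ^+ 2 <= N.+1%:R.
  by exists (Num.truncn ((rmax / (eps / 3)) ^+ 2)); rewrite ltW// truncnS_gt.
have e3 : 0 < eps / 3 by rewrite divr_gt0.
have [n0 Mn0 hx] := x_windows N M e3.
(* [c] is normalized to be 1 in the middle of the window, at index N *)
pose c k : R[i] := if (k <= N)%N then (l / rmax%:C) ^+ (N - k) else (rmin%:C / l) ^+ (k - N).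
pose a k : R := if (k < N)%N then rmax else rmin.
have R0 : rmax%:C != 0 :> R[i] by apply/eqP => -[] h; move: rmax_gt0; rewrite h ltxx.
have rec k : (a k)%:C * c k = l * c k.+1.
  rewrite /a /c; case: (ltnP k N) => kN.
    rewrite (ltnW kN) -(subnSK kN) exprS.
    by field.
  have -> : (if (k <= N)%N then (l / rmax%:C) ^+ (N - k) else (rmin%:C / l) ^+ (k - N)) =
     (rmin%:C / l) ^+ (k - N).
    case: leqP => // kN'; have -> : k = N by apply/eqP; rewrite eqn_leq kN kN'.
    by rewrite subnn !expr0.
  by rewrite subSn// exprS; field.
set m := (N + N)%N.
pose u := bsum c n0 m.+1.
have uE : rnorm u ^+ 2 = \sum_(0 <= k < m.+1) rnorm (c k) ^+ 2 by exact: rnorm_bsum.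
have q1 : 0 <= rnorm (l / rmax%:C) <= 1.
  rewrite rnorm_ge0 rnormM rnormV rnorm_real ger0_norm ?(ltW rmax_gt0)//.
  by rewrite ler_pdivrMr ?mul1r.
have p1 : 0 <= rnorm (rmin%:C / l) <= 1.
  by rewrite rnorm_ge0 rnormM rnormV rnorm_real ger0_norm// ler_pdivrMr ?mul1r.
have sumge (b : R) i j : (i <= j)%N -> (j <= m.+1)%N ->
    (forall k, (i <= k)%N -> (k < j)%N -> b <= rnorm (c k) ^+ 2) ->
    (j - i)%:R * b <= rnorm u ^+ 2.
  move=> ij jm h; rewrite uE (big_cat_nat (n := j))//= (big_cat_nat (n := i))//=.
  have s0 p q : 0 <= \sum_(p <= k < q) rnorm (c k) ^+ 2 by apply: sumr_ge0 => k _; exact: sqr_ge0.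
  suff : (j - i)%:R * b <= \sum_(i <= k < j) rnorm (c k) ^+ 2.
    by have := s0 0%N i; have := s0 j m.+1; lra.
  rewrite mulr_natl -sumr_const_nat; apply: ler_sum_nat => k /andP[]; exact: h.
have c0E : c 0%N = (l / rmax%:C) ^+ N by rewrite /c /= subn0.
have cmE : c m = (rmin%:C / l) ^+ N.
  rewrite /c /m; case: leqP => [|_]; last by rewrite addnK.
  by rewrite -{3}(addn0 N) leq_add2l leqn0 => /eqP ->; rewrite !expr0.
have hc0 : N.+1%:R * rnorm (c 0%N) ^+ 2 <= rnorm u ^+ 2.
  rewrite -[N.+1]subn0; apply: sumge => //; first by rewrite /m ltnS leq_addr.
  move=> k _; rewrite ltnS => kN; rewrite ler_sqr ?nnegrE ?rnorm_ge0//.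
  by rewrite c0E /c kN !rnormX ler_wiXn2l ?leq_subr//; case/andP: q1.
have hcm : N.+1%:R * rnorm (c m) ^+ 2 <= rnorm u ^+ 2.
  rewrite -[N.+1](_ : (m.+1 - N)%N = _); last by rewrite /m -addnS addKn.
  apply: sumge => //; first by rewrite /m -addnS leq_addr.
  move=> k Nk; rewrite ltnS => kN; rewrite ler_sqr ?nnegrE ?rnorm_ge0//.
  have -> : c k = (rmin%:C / l) ^+ (k - N).
    rewrite /c; case: leqP => // kN'; have -> : k = N by apply/eqP; rewrite eqn_leq Nk kN'.
    by rewrite subnn !expr0.
  rewrite cmE !rnormX ler_wiXn2l//; [by case/andP: p1|by case/andP: p1|].
  by rewrite leq_subLR.
have u1 : 1 <= rnorm u ^+ 2.
  have := sumge 1 N N.+1 (leqnSn _); rewrite subSnn mul1r; apply; first by rewrite /m ltnS leq_addr.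
  move=> k Nk; rewrite ltnS => kN; have -> : k = N by apply/eqP; rewrite eqn_leq Nk kN.
  by rewrite /c leqnn subnn expr0 rnorm1 expr1n.
have u0 : 0 < rnorm u.
  rewrite lt_def rnorm_ge0 andbT; apply: contraTneq u1 => ->.
  by rewrite expr0n -ltNge.
have small b : 0 <= b -> N.+1%:R * b ^+ 2 <= rnorm u ^+ 2 -> rmax * b <= eps / 3 * rnorm u.
  move=> b0 hb; rewrite -ler_sqr ?nnegrE ?mulr_ge0 ?rnorm_ge0 ?(ltW rmax_gt0)//; last exact: ltW.
  have h : rmax ^+ 2 * b ^+ 2 = (eps / 3) ^+ 2 * ((rmax / (eps / 3)) ^+ 2 * b ^+ 2).
    by field; rewrite gt_eqF.
  rewrite !exprMn h -exprMn ler_wpM2l ?sqr_ge0// (le_trans _ hb)//.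
  by rewrite ler_wpM2r ?sqr_ge0.
have AuE : sub_scalar T l u = ((x (n0 + m)%N)%:C * c m) *: e (n0.+1 + m)%N - (l * c 0%N) *: e n0
    + bsum (fun k => (x (n0 + k)%N - a k)%:C * c k) n0.+1 m.
  rewrite sub_scalarE T_bsum bsumS /u [in X in _ - X]bsum_recl scalerDr scalerA bsumZ.
  rewrite opprD [X in X + _]addrC addrACA; congr (_ + _).
  rewrite bsumB; apply: eq_bigr => k _; congr (_ *: _).
  by rewrite -rec rmorphB /=; ring.
have Au : rnorm (sub_scalar T l u) <= eps * rnorm u.
  rewrite AuE (le_trans (rnormD _ _))//.
  have -> : eps = eps / 3 + eps / 3 + eps / 3 by field.
  rewrite mulrDl lerD//.
    rewrite (le_trans (rnormD _ _))// mulrDl rnormN !rnormZ !(rnorm_e dot_norm e_onb) !mulr1 lerD//.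
      rewrite rnormM rnorm_real ger0_norm//.
      apply: le_trans (small _ (rnorm_ge0 _) hcm); rewrite ler_wpM2r ?rnorm_ge0//.
      by case/andP: (x_bnd (n0 + m)%N).
    rewrite rnormM; apply: le_trans (small _ (rnorm_ge0 _) hc0).
    by rewrite ler_wpM2r ?rnorm_ge0.
  have e3' := ltW e3; have eu0 : 0 <= eps / 3 * rnorm u by rewrite mulr_ge0 ?rnorm_ge0.
  rewrite -ler_sqr ?nnegrE ?rnorm_ge0// rnorm_bsum exprMn.
  apply: (@le_trans _ _ ((eps / 3) ^+ 2 * \sum_(0 <= k < m) rnorm (c k) ^+ 2)).
    rewrite mulr_sumr; apply: ler_sum_nat => k /andP[_ km].
    rewrite rnormM exprMn rnorm_real ler_wpM2r ?sqr_ge0//.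
    by rewrite ler_sqr ?nnegrE//; exact/ltW/hx.
  by rewrite ler_wpM2l ?sqr_ge0// uE big_nat_recr//= lerDl sqr_ge0.
have [v [bv hv]] := block_normalize u0 (block_bsum c n0 m.+1) Au.
exists (n0 + m.+1)%N, v; split => //; first by rewrite (leq_trans Mn0)// leq_addr.
by have [c' vE c'0] := bv; exists c' => // k kM; apply: c'0; exact: leq_trans kM _.
Qed.

Lemma range_not_closed_annulus l : annulus0 rmin rmax l -> (l != 0 \/ forall n, 0 < x n) ->
  ~ closed (range (sub_scalar T l)).
Proof.
move=> lA l0; apply: range_not_closed.
- exact: sub_scalar_cont.
- exact: sub_scalar_coord_bound.
- by move=> eps M e0; have [N [u [h1 h2 h3]]] := approx_eigenvector lA M e0; exists N, u.
Qed.

Lemma approx_point_spectrumE : approx_point_spectrum T = annulus0 rmin rmax.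
Proof.
apply/seteqP; split => l; last first.
  move=> lA [c c0 hc]; have [|N [u [_ _ [u1 h]]]] := @approx_eigenvector l lA (c / 2) 0.
    by rewrite divr_gt0.
  have := hc u; rewrite u1 mulr1; move: h; lra.
by move=> nb; apply: contrapT => /bounded_below_off_annulus.
Qed.

(** Inside the inner disc the adjoint has a kernel; on the annulus a surjective
    operator would have closed range; and [e 0] is orthogonal to the range of [T]. *)
Lemma surjectivity_spectrumE : surjectivity_spectrum T = cdisc0 rmax.
Proof.
apply/seteqP; split => l.
  move=> ns; rewrite /cdisc0 /= leNgt; apply/negP => /surjective_outside; exact: ns.
rewrite /cdisc0 /mkset => lR sl.
have [l0|l0] := eqVneq l 0.
  have [v _ hv] : range (sub_scalar T l) (e 0%N) by rewrite sl.
  have := sub_scalar_coord0 l v; rewrite hv l0 oppr0 mul0r (dot_ee e_onb) eqxx => /eqP.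
  by rewrite oner_eq0.
have [lr|rl] := ltP (rnorm l) rmin; last first.
  apply: (@range_not_closed_annulus l); [by rewrite /annulus0 /= rl|by left|].
  by rewrite sl; exact: closedT.
have [|v v0] := @adj_eigen_inner (Num.conj l); first by rewrite rnorm_Conj.
by rewrite surjective_ker_adjoint// => /= vE; rewrite vE eqxx in v0.
Qed.

Lemma spectrumE : spectrum T = cdisc0 rmax.
Proof.
apply/seteqP; split => l; last first.
  rewrite -surjectivity_spectrumE => ns iT; apply: ns; exact: invertible_surjective.
move=> ni; rewrite /cdisc0 /= leNgt; apply/negP => lR; apply: ni.
apply: invertible_of_bounded_below; last exact: surjective_outside.
by apply: bounded_below_off_annulus; rewrite /annulus0 /= => /andP[_]; rewrite leNgt lR.
Qed.

(** The range is not closed, unless [l = 0] and infinitely many weights vanish, in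
    which case both kernels are infinite dimensional. *)
Lemma not_semi_fredholm_annulus l : (forall n, 0 < x n) \/ zeros_io ->
  annulus0 rmin rmax l -> ~ semi_fredholm dot (sub_scalar T l).
Proof.
move=> hz lA [cl].
have [l0|l0] := eqVneq l 0; last by move=> _; apply: (range_not_closed_annulus lA _ cl); left.
case: hz => [x0 _|z]; first by apply: (range_not_closed_annulus lA _ cl); right.
by rewrite ker_adjoint_sub l0 op_ker_sub0 rmorph0 ker_infty// adj_eigen0_infty// => -[].
Qed.

Lemma ess_spectrumE : (forall n, 0 < x n) \/ zeros_io ->
  ess_spectrum dot T = annulus0 rmin rmax.
Proof.
move=> hz; apply/seteqP; split => l; last first.
  by move=> /(not_semi_fredholm_annulus hz) h /fredholm_semi.
by move=> nf; apply: contrapT => /fredholm_off_annulus.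
Qed.

Lemma lre_spectrumE : (forall n, 0 < x n) \/ zeros_io ->
  lre_spectrum dot T = annulus0 rmin rmax.
Proof.
move=> hz; apply/seteqP; split => l; last exact: not_semi_fredholm_annulus.
by move=> nf; apply: contrapT => /fredholm_off_annulus/fredholm_semi.
Qed.

(** On a window with weights close to [rmax], a vector with coefficients of constant
    modulus and steadily rotating argument gives a value of the quadratic form
    with the argument of [z] and modulus larger than that of [z]. Mixing this vector
    with a far basis vector, on which the form vanishes, brings the modulus down to
    exactly that of [z]. *)
Lemma num_range_block z : rnorm z < rmax -> forall M,
  exists N u, [/\ (M <= N)%N, block M N u & rnorm u = 1 /\ dot (T u) u = z].
Proof.
move=> zR M.
(* eps is such that m (rmax - eps) > (m + 1) |z| for large m *)
pose eps := (rmax - rnorm z) / 2.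
have e0 : 0 < eps by rewrite divr_gt0// subr_gt0.
have [m hm] : exists m : nat, rmax / eps < m.+1%:R.
  by exists (Num.truncn (rmax / eps)); exact: truncnS_gt.
have [n0 Mn0 hx] := x_windows m.+1 M e0.
pose zeta : R[i] := if z == 0 then 1 else Num.conj z / (rnorm z)%:C.
have z1 : zeta * Num.conj zeta = 1.
  rewrite /zeta; case: eqP => [_|/eqP z0]; first by rewrite rmorph1 mulr1.
  have zp : (rnorm z)%:C != 0 :> R[i] by apply/eqP => -[] h; have := rnorm_gt0 z0; rewrite h ltxx.
  rewrite rmorphM fmorphV /= conjCK [Num.conj (rnorm z)%:C]conjc_real.
  rewrite mulrACA (mulrC (Num.conj z)) mulJ_rnorm rmorphXn /= -invfM -expr2 mulfV//.
  by rewrite expf_neq0.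
have zE : z = Num.conj zeta * (rnorm z)%:C.
  rewrite /zeta; case: eqP => [->|/eqP z0]; first by rewrite rnorm0 mulr0.
  have zp : (rnorm z)%:C != 0 :> R[i] by apply/eqP => -[] h; have := rnorm_gt0 z0; rewrite h ltxx.
  by rewrite rmorphM fmorphV /= conjCK [Num.conj (rnorm z)%:C]conjc_real mulfVK.
have zn k : rnorm (zeta ^+ k) = 1.
  rewrite rnormX; suff -> : rnorm zeta = 1 by rewrite expr1n.
  apply/eqP; rewrite -sqrp_eq1 ?rnorm_ge0//; apply/eqP/complexI.
  by rewrite -mulJ_rnorm z1.
pose w := bsum (fun k => zeta ^+ k) n0 m.+1.
have wn : rnorm w ^+ 2 = m.+1%:R.
  rewrite /w rnorm_bsum; under eq_bigr do rewrite zn expr1n.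
  by rewrite sumr_const_nat subn0.
pose S : R := \sum_(0 <= k < m) x (n0 + k)%N.
have Sge : m.+1%:R * rnorm z < S.
  have hS : m%:R * (rmax - eps) <= S.
    rewrite /S mulr_natl -[X in _ *+ X](subn0 m) -sumr_const_nat.
    apply: ler_sum_nat => k /andP[_ km]; have := hx k.
    rewrite (ltn_addr _ (ltnW km : k < m.+1)%N) => /(_ isT).
    by rewrite (ltnW km : (k < m.+1)%N) ltr_norml => /andP[h _]; move: h; lra.
  apply: lt_le_trans hS.
  have -> : rnorm z = rmax - 2 * eps by rewrite /eps; field.
  move: hm; rewrite ltr_pdivrMr// -natr1 !mulrDl !mul1r.
  lra.
have Tw : dot (T w) w = Num.conj zeta * S%:C.
  rewrite /w T_bsum bsumS [in X in dot _ X]bsum_recl dotDl !dotDr !dotZl !dotZr.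
  rewrite [dot (bsum _ _ _) (e n0)]dot_conj.
  have h1 c : dot (e n0) (bsum c n0.+1 m) = 0.
    have [c' -> c'0] := block_bsum c n0.+1 m.
    by rewrite dot_conj (dot_fsum e_onb) c'0// if_same rmorph0.
  have h2 c : dot (e (n0.+1 + m)%N) (bsum c n0.+1 m) = 0.
    by rewrite dot_conj dot_bsum_e ?rmorph0.
  have h3 : dot (e (n0.+1 + m)%N) (e n0) = 0.
    by rewrite (dot_ee e_onb) gtn_eqF// addSn ltnS leq_addr.
  rewrite h1 h2 h3 rmorph0 !mulr0 add0r !addr0 dot_bsum /S rmorph_sum mulr_sumr.
  apply: eq_bigr => k _; rewrite exprS rmorphM /=.
  have -> : (x (n0 + k))%:C * zeta ^+ k * (Num.conj zeta * Num.conj (zeta ^+ k)) =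
    (x (n0 + k))%:C * Num.conj zeta * (zeta ^+ k * Num.conj (zeta ^+ k)) by ring.
  by rewrite mulJ_rnorm zn expr1n mulr1 mulrC.
have S0 : 0 < S by apply: le_lt_trans Sge; rewrite mulr_ge0 ?rnorm_ge0.
(* squared moduli of the coefficients of the mixture a w + b e_p *)
pose a2 := rnorm z / S.
pose b2 := 1 - m.+1%:R * a2.
have a20 : 0 <= a2 by rewrite divr_ge0 ?rnorm_ge0 ?ltW.
have b20 : 0 <= b2.
  by rewrite subr_ge0 /a2 mulrA ler_pdivrMr// mul1r ltW.
pose a := (Num.sqrt a2)%:C : R[i]; pose b := (Num.sqrt b2)%:C : R[i].
have aa : a * Num.conj a = a2%:C.
  by rewrite mulJ_rnorm rnorm_real real_normK ?num_real// sqr_sqrtr.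
have bb : b * Num.conj b = b2%:C.
  by rewrite mulJ_rnorm rnorm_real real_normK ?num_real// sqr_sqrtr.
(* one index is skipped, so that T w is orthogonal to e p *)
set p := (n0 + m.+2)%N.
have wp q : (p <= q.+1)%N -> dot w (e q) = 0.
  by rewrite /p addnS ltnS => h; rewrite dot_bsum_e.
pose u := a *: w + b *: e p.
have Tu : dot (T u) u = z.
  rewrite /u [T (_ + _)]linearD ![T (_ *: _)]linearZ /= T_shift dotDl !dotDr !dotZl !dotZr Tw.
  have h1 : dot (T w) (e p) = 0.
    by rewrite /p addnS T_coordS wp ?mulr0// /p addnS.
  have h2 : dot (e p.+1) w = 0 by rewrite dot_conj wp ?rmorph0// leqW.
  have h3 : dot (e p.+1) (e p) = 0 by rewrite (dot_ee e_onb) gtn_eqF.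
  rewrite h1 h2 h3 !mulr0 !addr0 !mulrA aa [RHS]zE mulrAC -rmorphM /= /a2.
  by rewrite mulfVK ?gt_eqF// mulrC.
have un : rnorm u = 1.
  apply/eqP; rewrite -sqrp_eq1 ?rnorm_ge0//; apply/eqP.
  rewrite /u (pythagoras dot_norm); last by rewrite dotZl dotZr wp ?mulr0// leqnSn.
  rewrite !rnormZ !exprMn (rnorm_e dot_norm e_onb) wn !rnorm_real !real_normK ?num_real//.
  by rewrite !sqr_sqrtr// /b2; ring.
exists p.+1, u; split => //; first by rewrite (leq_trans Mn0)// /p leqW// leq_addr.
have bw : block n0 (n0 + m.+1) w by exact: block_bsum.
have n0p : (n0 <= p)%N by rewrite leq_addr.
have mp : (n0 + m.+1 <= p)%N by rewrite leq_add2l.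
have [c uE c0] := block_extend a b bw n0p mp.
by exists c => // k kM; apply: c0; exact: leq_trans kM Mn0.
Qed.

Lemma num_rangeE : num_range dot T = odisc0 rmax.
Proof.
apply/seteqP; split => z; first exact: num_range_sub.
by move=> /num_range_block/(_ 0%N)[N [u [_ _ [u1 <-]]]]; exists u.
Qed.

(** On one of the orthonormal blocks that realize [z] for [T], the compact
    perturbation is negligible. *)
Lemma num_range_compact (K : {linear H -> H}) z (eps : R) : compact_op K -> rnorm z < rmax ->
  0 < eps -> exists2 u, rnorm u = 1 & rnorm (dot ((T \+ K) u) u - z) < eps.
Proof.
move=> cK zR e0.
have [|u [Qu u0 _]] := @block_sequence (fun _ u => rnorm u = 1 /\ dot (T u) u = z).
  by move=> _ M; exact: num_range_block.
have u1 j : rnorm (u j) = 1 by case: (Qu j).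
have [j hj] := compact_small dot_norm cK u1 u0 e0; exists (u j) => //=.
by rewrite dotDl; have [_ ->] := Qu j; rewrite addrC addKr.
Qed.

Let norm_gap (o M rz rd rt rdz : R) : rz = (o + M) / 2 -> rz - rd <= rdz ->
  rdz < (M - o) / 2 -> rd <= rt -> rt <= o -> False.
Proof. by move=> -> ? ? ? ?; lra. Qed.

Let mid_lt (o M : R) : o < M -> (o + M) / 2 < M.
Proof. by move=> ?; lra. Qed.

(** The norm bounds the quadratic form, which comes close to every point of the open
    disc by [num_range_compact]. *)
Lemma op_norm_compact_ge (K : {linear H -> H}) : compact_op K -> rmax <= op_norm (T \+ K).
Proof.
move=> cK; rewrite leNgt; apply/negP => lt.
have [C hC] := compact_bounded cK.
have ub : has_ubound [set rnorm ((T \+ K) v) | v in [set v | rnorm v <= 1]].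
  exists (rmax + C) => _ [v v1 <-] /=; rewrite (le_trans (rnormD _ _))// lerD ?hC//.
  by rewrite (le_trans (T_rnorm_le _))// ler_piMr// ltW.
have n0 : 0 <= op_norm (T \+ K).
  rewrite -(@rnorm0 R H) -(linear0 (T \+ K)); apply: (ub_le_sup ub).
  by exists 0 => //=; rewrite rnorm0 ler01.
pose z : R[i] := ((op_norm (T \+ K) + rmax) / 2)%:C.
have zE : rnorm z = (op_norm (T \+ K) + rmax) / 2.
  by rewrite rnorm_real ger0_norm// divr_ge0// addr_ge0// ltW.
have zR : rnorm z < rmax by rewrite zE mid_lt.
have e0 : 0 < (rmax - op_norm (T \+ K)) / 2 by rewrite divr_gt0// subr_gt0.
have [u u1 hu] := num_range_compact cK zR e0.
have h1 : rnorm ((T \+ K) u) <= op_norm (T \+ K).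
  by apply: (ub_le_sup ub); exists u => //=; rewrite u1.
have h2 := cauchy_schwarz dot_norm ((T \+ K) u) u; rewrite u1 mulr1 in h2.
have h3 := rnormB_ge z (dot ((T \+ K) u) u); rewrite rnormC in h3.
exact: norm_gap zE h3 hu h2 h1.
Qed.

Lemma op_normE : op_norm T = rmax.
Proof.
apply/eqP; rewrite eq_le; apply/andP; split.
  apply: ge_sup; first by exists (rnorm (T 0)), 0 => //=; rewrite rnorm0 ler01.
  by move=> _ [v v1 <-]; rewrite (le_trans (T_rnorm_le _))// ler_piMr// ltW.
have := op_norm_compact_ge (@compact_op0 R H); congr (_ <= _).
by congr (sup _); apply/seteqP; split => _ [v v1 <-]; exists v => //=; rewrite addr0.
Qed.

Lemma ess_normE : ess_norm T = rmax.
Proof.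
have lb : lbound [set op_norm (T \+ K) | K in compact_op] rmax.
  by move=> _ [K cK <-]; exact: op_norm_compact_ge.
have r_in : [set op_norm (T \+ K) | K in compact_op] rmax.
  exists (\0 : {linear H -> H}); first exact: (@compact_op0 R H).
  rewrite -op_normE; congr (sup _).
  by apply/seteqP; split => _ [v v1 <-]; exists v => //=; rewrite addr0.
apply/eqP; rewrite eq_le; apply/andP; split.
  by apply: ge_inf => //; exists rmax.
by apply: lb_le_inf => //; exists rmax.
Qed.

Lemma closure_odisc (V : set R[i]) : (forall z eps, rnorm z < rmax -> 0 < eps ->
    exists2 v, V v & rnorm (v - z) < eps) ->
  cdisc0 rmax `<=` closure (V : set R[i]^o).
Proof.
move=> h z zR; apply/closure_rnormP => eps e0.
(* z is approximated by the point (1 - t) z of the open disc *)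
pose t := Num.min 1 (eps / 2 / rmax).
have t0 : 0 < t by rewrite lt_min ltr01 !divr_gt0.
have t1 : t <= 1 by rewrite ge_min lexx.
have tR : t * rmax <= eps / 2 by rewrite -ler_pdivlMr// ge_min lexx orbT.
pose z' := (1 - t)%:C * z.
have z'R : rnorm z' < rmax.
  rewrite rnormM rnorm_real ger0_norm ?subr_ge0//.
  have : (1 - t) * rnorm z <= (1 - t) * rmax by rewrite ler_wpM2l// subr_ge0.
  have := mulr_gt0 t0 rmax_gt0; lra.
have e2 : 0 < eps / 2 by rewrite divr_gt0.
have [v Vv hv] := h z' _ z'R e2; exists v => //.
rewrite (le_lt_trans (rnorm_tri _ z' _))//.
have : rnorm (z' - z) <= eps / 2.
  have -> : z' - z = (- t)%:C * z by rewrite /z' rmorphB rmorphN /=; ring.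
  rewrite rnormM rnorm_real normrN gtr0_norm// (le_trans _ tR)// ler_wpM2l// ltW//.
move: hv; lra.
Qed.

Lemma ess_num_rangeE : ess_num_range dot T = cdisc0 rmax.
Proof.
apply/seteqP; split => z; last first.
  move=> zR K cK; move: z zR; apply: closure_odisc => z eps zR e0.
  have [u u1 hu] := num_range_compact cK zR e0.
  by exists (dot ((T \+ K) u) u) => //; exists u.
move=> /(_ (\0 : {linear H -> H}) (@compact_op0 R H)) /closure_rnormP h.
rewrite /cdisc0 /=; apply/ler_addgt0Pr => eps /h[v [u u1 <-] hv].
have uE : num_range dot T (dot (T u) u) by exists u.
move: hv; rewrite /= addr0 => hv.
have := num_range_sub uE; have := rnormB_ge z (dot (T u) u); rewrite rnormC.
move: hv; rewrite /rnorm /=; lra.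
Qed.

Lemma sup_disc (V : set R[i]) : odisc0 rmax `<=` V -> V `<=` cdisc0 rmax ->
  sup [set rnorm z | z in V] = rmax.
Proof.
move=> h1 h2; apply/eqP; rewrite eq_le; apply/andP; split.
  apply: ge_sup; last by move=> _ [z /h2 zV <-].
  by exists (rnorm (0 : R[i])), 0 => //; apply: h1; rewrite /odisc0 /= rnorm0.
rewrite leNgt; apply/negP => lt.
have ub : has_ubound [set rnorm z | z in V] by exists rmax => _ [z /h2 zV <-].
have s0 : 0 <= sup [set rnorm z | z in V].
  rewrite -(@rnorm0 R R[i]); apply: (ub_le_sup ub); exists 0 => //.
  by apply: h1; rewrite /odisc0 /= rnorm0.
pose z : R[i] := ((sup [set rnorm z | z in V] + rmax) / 2)%:C.
have zE : rnorm z = (sup [set rnorm z | z in V] + rmax) / 2.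
  by rewrite rnorm_real ger0_norm// divr_ge0// addr_ge0// ltW.
have : rnorm z <= sup [set rnorm z | z in V].
  by apply: (ub_le_sup ub); exists z => //; apply: h1; rewrite /odisc0 /mkset zE; lra.
rewrite zE; lra.
Qed.

Lemma num_radiusE : num_radius dot T = rmax.
Proof.
rewrite /num_radius num_rangeE; apply: sup_disc => // z; rewrite /odisc0 /cdisc0 /=.
exact: ltW.
Qed.

Lemma spectral_radiusE : spectral_radius T = rmax.
Proof.
rewrite /spectral_radius spectrumE; apply: sup_disc => // z; rewrite /odisc0 /cdisc0 /=.
exact: ltW.
Qed.

End Shift.

(** * Independent identically distributed sequences *)

Lemma ae_imply d (T : measurableType d) (R : realType) (mu : {measure set T -> \bar R})
    (Q Q' : T -> Prop) : {ae mu, forall t, Q t} -> (forall t, Q t -> Q' t) ->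
  {ae mu, forall t, Q' t}.
Proof. by move=> h QQ'; apply: negligibleS h => t /= nQ' Qt; apply: nQ'; exact: QQ'. Qed.

Lemma ae_and d (T : measurableType d) (R : realType) (mu : {measure set T -> \bar R})
    (Q Q' : T -> Prop) : {ae mu, forall t, Q t} -> {ae mu, forall t, Q' t} ->
  {ae mu, forall t, Q t /\ Q' t}.
Proof.
move=> h h'; apply: negligibleS (negligibleU h h') => t /= /not_andP[]; by [left|right].
Qed.

Lemma ae_forall_nat d (T : measurableType d) (R : realType) (mu : {measure set T -> \bar R})
    (Q : nat -> T -> Prop) : (forall n, {ae mu, forall t, Q n t}) ->
  {ae mu, forall t, forall n, Q n t}.
Proof.
move=> h; apply: (@negligibleS _ _ _ mu (\bigcup_n ~` (Q n))); last exact: negligible_bigcup.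
by move=> t /= /existsNP[n hn]; exists n.
Qed.

Section SequenceSpace.
Variable R : realType.
Implicit Types (B : nat -> set R) (v : nat -> R).

Definition cylinder n B : set (nat -> R) := [set v | forall i, (i < n)%N -> B i (v i)].

Definition cylinders : set (set (nat -> R)) :=
  [set A | exists n B, (forall i, measurable (B i)) /\ A = cylinder n B].

Notation seqT := (g_sigma_algebraType cylinders).

Lemma measurable_cylinder n B : (forall i, measurable (B i)) ->
  measurable (cylinder n B : set seqT).
Proof. by move=> mB; apply: sub_sigma_algebra; exists n, B. Qed.

Lemma cylinders_setI : setI_closed cylinders.
Proof.
move=> _ _ [n [B [mB ->]]] [n' [B' [mB' ->]]].
pose F i := (if (i < n)%N then B i else setT) `&` (if (i < n')%N then B' i else setT).
exists (maxn n n'), F; split.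
  by move=> i; apply: measurableI; case: ifP.
apply/seteqP; split => v.
  by move=> [h h'] i _; split; case: ifP => // ilt; [exact: h|exact: h'].
move=> h; split => i ilt.
  by have [] := h i (leq_trans ilt (leq_maxl _ _)); rewrite ilt.
by have [] := h i (leq_trans ilt (leq_maxr _ _)); rewrite ilt.
Qed.

Lemma cylinder0 B : cylinder 0 B = setT.
Proof. by apply/seteqP; split => // v _ i. Qed.

(** Dynkin's lemma for the pi-system of cylinders. *)
Lemma cylinder_unique (m1 m2 : {measure set seqT -> \bar R}) :
  (m1 setT < +oo)%E ->
  (forall n B, (forall i, measurable (B i)) -> m1 (cylinder n B) = m2 (cylinder n B)) ->
  forall A, measurable A -> m1 A = m2 A.
Proof.
move=> foo h A mA; apply: (@measure_unique _ R seqT cylinders (fun=> setT) _ _ _ _ m1 m2) => //.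
- exact: cylinders_setI.
- by move=> i; exists 0%N, (fun=> setT); rewrite cylinder0.
- by rewrite bigcup_const//; exists 0%N.
- by move=> _ [n [B [mB ->]]]; exact: h.
Qed.

Definition shift N v : nat -> R := fun i => v (N + i)%N.

Lemma shift_cylinder N n B B' :
  cylinder N B `&` shift N @^-1` cylinder n B' =
  cylinder (N + n) (fun i => if (i < N)%N then B i else B' (i - N)%N).
Proof.
apply/seteqP; split => v.
  move=> [h h'] i ilt; case: ltnP => iN; first exact: h.
  have := h' (i - N)%N; rewrite /shift subnKC//; apply.
  by rewrite ltn_subLR.
move=> h; split => i ilt.
  by have := h i (ltn_addr _ ilt); rewrite ilt.
by have := h (N + i)%N; rewrite ltn_add2l ilt ltnNge leq_addr /= addKn; exact.
Qed.

Lemma measurable_shift N : measurable_fun [set: seqT] (shift N : seqT -> seqT).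
Proof.
apply: (@measurability _ _ seqT seqT setT (shift N) cylinders erefl) => _ [_ [n [B [mB ->]]] <-].
rewrite (_ : setT = cylinder N (fun=> setT)); last by apply/seteqP; split.
rewrite shift_cylinder; apply: measurable_cylinder => i.
by case: ifP.
Qed.

Lemma measurable_coord i : measurable_fun [set: seqT] (fun v : seqT => v i).
Proof.
move=> _ B mB; rewrite setTI.
rewrite (_ : _ @^-1` _ = cylinder i.+1 (fun j => if j == i then B else setT)).
  by apply: measurable_cylinder => j; case: ifP.
apply/seteqP; split => v /=; first by move=> h j _; case: eqP => // ->.
by move=> /(_ i (ltnSn i)); rewrite eqxx.
Qed.

Lemma shiftD M N v : shift M (shift N v) = shift (N + M) v.
Proof. by apply/funext => i; rewrite /shift addnA. Qed.

Lemma shift0 v : shift 0 v = v.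
Proof. exact/funext. Qed.

Section Iid.
Variables (mu : probability seqT R) (rho : set R -> \bar R).
Hypothesis mu_cylinder : forall n B, (forall i, measurable (B i)) ->
  mu (cylinder n B) = (\prod_(0 <= i < n) rho (B i))%E.

Lemma measurable_preshift N (A : set seqT) :
  measurable A -> measurable (shift N @^-1` A : set seqT).
Proof. by move=> mA; rewrite -[X in measurable X]setTI; exact: measurable_shift. Qed.

(** Independence of the first [N] coordinates and of the following ones: both
    sides are finite measures in [A] that agree on cylinders. *)
Lemma mu_cylinder_shift N B (A : set seqT) : (forall i, measurable (B i)) -> measurable A ->
  mu (cylinder N B `&` shift N @^-1` A) = (mu (cylinder N B) * mu A)%E.
Proof.
move=> mB mA; have mC := measurable_cylinder N mB.
pose m1 : {measure set seqT -> \bar R} :=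
  measure_function_pushforward__canonical__measure_function_Measure
    (mrestr mu mC) (measurable_shift N).
have c0 : 0 <= fine (mu (cylinder N B)) by rewrite fine_ge0.
pose m2 : {measure set seqT -> \bar R} := mscale (NngNum c0) mu.
have muF : mu (cylinder N B) = (fine (mu (cylinder N B)))%:E.
  by rewrite fineK// fin_num_measure.
transitivity (m1 A); first by rewrite /m1 /= /pushforward /mrestr setIC.
transitivity (m2 A); last by rewrite /m2 /= /mscale /= -muF.
apply: cylinder_unique => //.
  rewrite /m1 /= /pushforward /mrestr preimage_setT setTI.
  by rewrite (le_lt_trans (probability_le1 _ _)) ?ltry.
move=> n B' mB'; rewrite /m1 /m2 /= /pushforward /mrestr /mscale /= -muF setIC shift_cylinder.
rewrite !mu_cylinder//; last by move=> i; case: ifP.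
rewrite (big_cat_nat (n := N))//= ?leq_addr//; congr (_ * _)%E.
  by apply: eq_big_nat => i /andP[_ ->].
rewrite -{1}(add0n N) big_addn addKn; apply: eq_big_nat => i _.
by rewrite ltnNge leq_addl /= addnK.
Qed.

Lemma mu_shift N (A : set seqT) : measurable A -> mu (shift N @^-1` A) = mu A.
Proof.
move=> mA; have E : cylinder N (fun=> setT) = setT by apply/seteqP; split.
have := @mu_cylinder_shift N (fun=> setT) A (fun=> measurableT) mA.
by rewrite E setTI probability_setT mul1e.
Qed.

Lemma ae_shift k (Q : seqT -> Prop) : {ae mu, forall v, Q v} ->
  {ae mu, forall v, Q (shift k v)}.
Proof.
move=> [N [mN N0 Nsub]]; exists (shift k @^-1` N); split.
- exact: measurable_preshift.
- by have := mu_shift k mN; rewrite N0.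
- by move=> v nQ; exact: Nsub.
Qed.

(** An invariant event is independent of every cylinder, hence of itself. *)
Lemma shift_invariant01 (J : set seqT) : measurable J -> shift 1 @^-1` J = J ->
  mu J = 0%E \/ mu J = 1%E.
Proof.
move=> mJ J1.
have JN N : shift N @^-1` J = J.
  elim: N => [|N IH]; first by apply/seteqP; split => v /=; rewrite shift0.
  rewrite -[RHS]IH -[in RHS]J1; apply/seteqP; split => v /=; by rewrite shiftD addn1.
have c0 : 0 <= fine (mu J) by rewrite fine_ge0.
pose m1 : {measure set seqT -> \bar R} := mrestr mu mJ.
pose m2 : {measure set seqT -> \bar R} := mscale (NngNum c0) mu.
have muF : mu J = (fine (mu J))%:E by rewrite fineK// fin_num_measure.
have : m1 J = m2 J.
  apply: cylinder_unique => //.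
    by rewrite /m1 /= /mrestr setTI (le_lt_trans (probability_le1 _ _)) ?ltry.
  move=> n B mB; rewrite /m1 /m2 /= /mrestr /mscale /= -muF.
  by rewrite -{1}(JN n) mu_cylinder_shift// muleC.
rewrite /m1 /m2 /= /mrestr /mscale /= setIid -muF muF => /eqP.
rewrite -EFinM eqe => /eqP h; have [->|j0] := eqVneq (fine (mu J)) 0; first by left.
by right; congr EFin; apply: (mulfI j0); rewrite mulr1 -h.
Qed.

(** Let [G] be the event that the pattern [B] occurs in no window. It is included
    in the complement of [cylinder N B] and in its own preimage by [shift N]; these
    are independent, so [mu G <= (1 - mu (cylinder N B)) * mu G] and [G] is null. *)
Lemma windows_io N B : (forall i, measurable (B i)) -> (0 < mu (cylinder N B))%E ->
  {ae mu, forall v, forall M, exists2 n, (M <= n)%N & cylinder N B (shift n v)}.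
Proof.
move=> mB C0; set C := cylinder N B.
have mC : measurable (C : set seqT) by exact: measurable_cylinder.
pose G : set seqT := \bigcap_n (shift n @^-1` (~` C)).
have mG : measurable G.
  by apply: bigcapT_measurable => n; apply: measurable_preshift; exact: measurableC.
have G0 : mu G = 0%E.
  have Gsub : G `<=` (shift N @^-1` G) `\` C.
    move=> v Gv; split; first by move=> n _ /=; rewrite shiftD; exact: Gv.
    by have := Gv 0%N Logic.I; rewrite /= shift0.
  have : (mu G <= mu ((shift N @^-1` G) `\` C))%E.
    apply: le_measure => //; rewrite inE//.
    by apply: measurableD => //; exact: measurable_preshift.
  have -> : mu ((shift N @^-1` G) `\` C) = (mu G - mu C * mu G)%E.
    have mSG : measurable (shift N @^-1` G : set seqT) by exact: measurable_preshift.
    rewrite measureD//; last first.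
      by rewrite (le_lt_trans (probability_le1 _ _)) ?ltry.
    congr (_ - _)%E; first exact: mu_shift.
    by rewrite setIC; exact: mu_cylinder_shift.
  have muG : mu G = (fine (mu G))%:E by rewrite fineK// fin_num_measure.
  have muC : mu C = (fine (mu C))%:E by rewrite fineK// fin_num_measure.
  move: C0; rewrite -/C muG muC -EFinM -EFinB lee_fin lte_fin lerBrDr gerDl => c0.
  rewrite pmulr_rle0// => g0; congr EFin; apply/eqP; rewrite eq_le g0.
  by rewrite fine_ge0.
apply: (@negligibleS _ _ _ mu (\bigcup_n (shift n @^-1` G : set seqT))).
  move=> v /= nv; apply: contrapT => nU; apply: nv => M; apply: contrapT => nM.
  apply: nU; exists M => // n _ /=; rewrite shiftD => Cv; apply: nM.
  by exists (M + n)%N => //; rewrite leq_addr.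
apply: negligible_bigcup => n; exists (shift n @^-1` G); split => //.
  exact: measurable_preshift.
by have := mu_shift n mG; rewrite G0.
Qed.

Lemma prob1_ae (J : set seqT) : measurable J -> mu J = 1%E -> {ae mu, forall v, J v}.
Proof.
move=> mJ J1; exists (~` J); split => //; first exact: measurableC.
by rewrite [LHS](probability_setC mu mJ) J1 subee.
Qed.

Lemma prob0_ae (J : set seqT) : measurable J -> mu J = 0%E -> {ae mu, forall v, ~ J v}.
Proof. by move=> mJ J0; exists J; split => // v /contrapT. Qed.

End Iid.

End SequenceSpace.

(** * Random walks *)

Lemma norm_max_opp_le (R : realType) (a b : R) : 0 <= b -> `|Num.max a (- b)| <= `|a|.
Proof.
move=> b0; have [ab|ba] := leP (- b) a; first by [].
rewrite normrN ger0_norm// ltr0_norm ?lerN2 //.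
  by rewrite lerNr ltW.
by rewrite (lt_le_trans ba)// oppr_le0.
Qed.

Lemma min_lipschitz (R : realType) (a b K : R) : `|Num.min a K - Num.min b K| <= `|a - b|.
Proof.
wlog ab : a b / a <= b => [h|].
  by have [/h//|/ltW/h] := leP a b; rewrite distrC [leRHS]distrC.
rewrite distrC [leRHS]distrC !ger0_norm ?subr_ge0//; last first.
  by rewrite le_min ge_min ab ge_min lexx orbT.
have [bK|Kb] := leP b K; have [aK|Ka] := leP a K; lra.
Qed.

Section Walk.
Variable R : realType.
Notation seqT := (g_sigma_algebraType (@cylinders R)).
Implicit Types v : nat -> R.
Variable f : R -> R.

Definition walk n v : R := \sum_(0 <= i < n) f (v i).

Lemma walkS n v : walk n.+1 v = f (v 0%N) + walk n (shift 1 v).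
Proof. by rewrite /walk big_nat_recl. Qed.

Lemma walkD m n v : walk (m + n) v = walk m v + walk n (shift m v).
Proof.
elim: m v => [|m IH] v; first by rewrite shift0 add0n /walk [X in _ = X + _]big_geq ?add0r.
by rewrite addSn !walkS IH addrA shiftD.
Qed.

(** The maximum of [0] and of the first [n] partial sums, in the recursive form used
    by Garsia's proof of the maximal ergodic theorem. *)
Fixpoint walk_max n v : R :=
  if n is k.+1 then Num.max 0 (f (v 0%N) + walk_max k (shift 1 v)) else 0.

Lemma walk_max_ge0 n v : 0 <= walk_max n v.
Proof. by case: n => //= n; rewrite le_max lexx. Qed.

Lemma walk_max_incr n v : walk_max n v <= walk_max n.+1 v.
Proof.
elim: n v => [|n IH] v; first exact: walk_max_ge0.
by rewrite [leLHS]/= ge_max walk_max_ge0 [leRHS]/= le_max lerD2l IH orbT.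
Qed.

Lemma walk_max_homo v : {homo walk_max ^~ v : m n / (m <= n)%N >-> m <= n}.
Proof.
by apply: homo_leq => [x|x y z|n]; [exact: lexx|exact: le_trans|exact: walk_max_incr].
Qed.

Lemma walk_le_max n v : walk n v <= walk_max n v.
Proof.
elim: n v => [|n IH] v; first by rewrite /walk big_geq.
by rewrite walkS /= le_max lerD2l IH orbT.
Qed.

Lemma walk_max_le C n v : (forall k, walk k v <= C) -> walk_max n v <= C.
Proof.
elim: n v C => [|n IH] v C h; first by have := h 0%N; rewrite /walk big_geq.
rewrite /= ge_max; apply/andP; split; first by have := h 0%N; rewrite /walk big_geq.
by rewrite -lerBrDl; apply: IH => k; rewrite lerBrDl -walkS.
Qed.

(** The value is [0] when the supremum is infinite; the detour by extended reals
    makes the measurability immediate. *)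
Definition walk_sup v : R := fine (ereal_sup (range (fun n => (walk_max n v)%:E))).

Lemma walk_sup_nneg v : 0 <= walk_sup v.
Proof. by apply: fine_ge0; apply: ereal_sup_ubound; exists 0%N. Qed.

Lemma walk_sup_ub C v : (forall n, walk_max n v <= C) -> forall n, walk_max n v <= walk_sup v.
Proof.
move=> h n; rewrite -lee_fin /walk_sup fineK.
  by apply: ereal_sup_ubound; exists n.
rewrite fin_real//; apply/andP; split.
  rewrite (lt_le_trans (ltNyr (walk_max 0 v)))//.
  by apply: ereal_sup_ubound; exists 0%N.
rewrite (@le_lt_trans _ _ C%:E) ?ltry//.
by apply: ge_ereal_sup => _ [m _ <-]; rewrite lee_fin.
Qed.

Lemma walk_sup_le C v : (forall n, walk_max n v <= C) -> walk_sup v <= C.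
Proof.
move=> h; rewrite -lee_fin /walk_sup fineK.
  by apply: ge_ereal_sup => _ [m _ <-]; rewrite lee_fin.
rewrite fin_real//; apply/andP; split.
  rewrite (lt_le_trans (ltNyr (walk_max 0 v)))//.
  by apply: ereal_sup_ubound; exists 0%N.
rewrite (@le_lt_trans _ _ C%:E) ?ltry//.
by apply: ge_ereal_sup => _ [m _ <-]; rewrite lee_fin.
Qed.

Lemma walk_sup_rec C v : (forall n, walk_max n v <= C) ->
  walk_sup v = Num.max 0 (f (v 0%N) + walk_sup (shift 1 v)).
Proof.
move=> h.
have h1 n : walk_max n (shift 1 v) <= C - f (v 0%N).
  by rewrite lerBrDl; apply: le_trans (h n.+1); rewrite /= le_max lexx orbT.
apply/eqP; rewrite eq_le; apply/andP; split.
  apply: walk_sup_le => -[|n] /=; first by rewrite le_max lexx.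
  rewrite ge_max le_max lexx /= le_max lerD2l.
  by rewrite (walk_sup_ub h1) orbT.
rewrite ge_max; apply/andP; split; first exact: (walk_sup_ub h 0%N).
rewrite -lerBrDl; apply: walk_sup_le => n; rewrite lerBrDl.
by apply: le_trans (walk_sup_ub h n.+1); rewrite /= le_max lexx orbT.
Qed.

(** The integer bounds make this event visibly measurable. *)
Definition to_ninfty v := forall C : nat, exists N, forall n, (N <= n)%N -> walk n v <= - C%:R.

Lemma to_ninfty_shift v : to_ninfty (shift 1 v) <-> to_ninfty v.
Proof.
split=> h C.
  have [N hN] := h (C + (Num.truncn (f (v 0%N))).+1)%N; exists N.+1.
  case=> [//|n]; rewrite ltnS => /hN.
  rewrite walkS natrD; have := truncnS_gt (f (v 0%N)); lra.
have [N hN] := h (C + (Num.truncn (- f (v 0%N))).+1)%N; exists N => n Nn.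
have := hN n.+1 (leqW Nn); rewrite walkS natrD; have := truncnS_gt (- f (v 0%N)); lra.
Qed.

Lemma to_ninfty_bounded v : to_ninfty v -> exists C, forall n, walk_max n v <= C.
Proof.
move=> h; have [N hN] := h 0%N; exists (walk_max N v) => n; apply: walk_max_le => k.
have [kN|/ltnW/hN] := leqP k N; first by rewrite (le_trans (walk_le_max k v))// walk_max_homo.
by rewrite oppr0 => /le_trans; apply; exact: walk_max_ge0.
Qed.

Lemma walk_sup_step v : to_ninfty v ->
  walk_sup v - walk_sup (shift 1 v) = Num.max (f (v 0%N)) (- walk_sup (shift 1 v)).
Proof.
move=> /to_ninfty_bounded[C /walk_sup_rec ->].
by rewrite addr_maxl sub0r addrK maxC.
Qed.

Hypothesis mf : measurable_fun [set: R] f.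

Lemma measurable_step : measurable_fun [set: seqT] (fun v : seqT => f (v 0%N)).
Proof. by apply: measurableT_comp => //; exact: measurable_coord. Qed.

Lemma measurable_comp_shift N (g : seqT -> R) : measurable_fun [set: seqT] g ->
  measurable_fun [set: seqT] (g \o shift N).
Proof. by move=> mg; apply: measurableT_comp => //; exact: measurable_shift. Qed.

Lemma measurable_walk n : measurable_fun [set: seqT] (walk n : seqT -> R).
Proof.
elim: n => [|n IH].
  by rewrite (_ : walk 0 = cst 0)//; apply/funext => v; rewrite /walk big_geq.
rewrite (_ : walk n.+1 = (fun v => f (v 0%N)) \+ (walk n \o shift 1)); last first.
  by apply/funext => v; rewrite walkS.
by apply: measurable_funD; [exact: measurable_step|exact: measurable_comp_shift].
Qed.

Lemma measurable_walk_max n : measurable_fun [set: seqT] (walk_max n : seqT -> R).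
Proof.
elim: n => [|n IH]; first exact: measurable_cst.
rewrite (_ : walk_max n.+1 = cst 0 \max ((fun v => f (v 0%N)) \+ (walk_max n \o shift 1)))//.
apply: measurable_maxr => //.
by apply: measurable_funD; [exact: measurable_step|exact: measurable_comp_shift].
Qed.

Lemma measurable_walk_sup : measurable_fun [set: seqT] (walk_sup : seqT -> R).
Proof.
apply: (measurableT_comp (fine_measurable measurableT)).
apply: (@emeasurable_fun_cvg _ seqT _ setT (fun n v => (walk_max n v)%:E)).
  by move=> n; apply/measurable_EFinP; exact: measurable_walk_max.
move=> v _; apply: ereal_nondecreasing_cvgn => m n mn.
by rewrite lee_fin; exact: walk_max_homo.
Qed.

Variables (mu : probability seqT R) (rho : set R -> \bar R).
Hypothesis mu_cylinder : forall n B, (forall i, measurable (B i)) ->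
  mu (cylinder n B) = (\prod_(0 <= i < n) rho (B i))%E.

Let integrable g := mu.-integrable [set: seqT] (EFin \o (g : seqT -> R)).

Let integral g := (\int[mu]_v (g v)%:E)%E.

Lemma integrable_shift g : integrable g ->
  integrable (g \o shift 1) /\ integral (g \o shift 1) = integral g.
Proof.
move=> ig; have := ig => /integrableP[/measurable_EFinP mg goo].
have mgs := measurable_comp_shift 1 mg.
pose nu : {measure set seqT -> \bar R} :=
  measure_function_pushforward__canonical__measure_function_Measure mu (@measurable_shift R 1).
have nuE (h : seqT -> \bar R) :
    (\int[mu]_v h v = \int[pushforward mu (shift 1 : seqT -> seqT)]_v h v)%E.
  apply/esym; apply: (@eq_measure_integral _ _ _ _ mu nu h) => A mA _.
  exact: (mu_shift mu_cylinder 1 mA).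
have igs : integrable (g \o shift 1).
  apply/integrableP; split; first exact/measurable_EFinP.
  apply: le_lt_trans goo; rewrite [leRHS]nuE ge0_integral_pushforward//.
    exact: measurable_shift.
  by apply: measurableT_comp => //; exact/measurable_EFinP.
split => //; rewrite /integral [RHS]nuE integral_pushforward//; first exact: measurable_shift.
exact/measurable_EFinP.
Qed.

Hypothesis f_int : integrable (fun v => f (v 0%N)).

Lemma integrable_walk_max n : integrable (walk_max n).
Proof.
elim: n => [|n IH0].
  rewrite /integrable (_ : EFin \o _ = cst 0%E)//; exact: integrable0.
have [IH _] := integrable_shift IH0.
apply: (le_integrable _ _ _ (integrableD _ f_int IH)) => //.
  by apply/measurable_EFinP; exact: measurable_walk_max.
move=> v _; rewrite /= lee_fin ger0_norm ?le_max ?lexx//.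
by rewrite ge_max normr_ge0 ler_norm.
Qed.

(** By [shift_invariant01] the sums are unbounded almost nowhere or almost
    everywhere. In the second case
    [walk_max n.+1 v - walk_max n (shift 1 v) = max (f (v 0)) (- walk_max n (shift 1 v))]
    tends to [f (v 0)] almost everywhere while its integral is nonnegative by
    invariance of [mu], so [f] has nonnegative integral. *)
Lemma walk_bounded : (integral (fun v => f (v 0%N)) < 0)%E ->
  {ae mu, forall v, exists C, forall n, walk n v <= C}.
Proof.
move=> neg.
pose J : set seqT := \bigcap_(C : nat) \bigcup_n [set v | C%:R < walk_max n v].
have mJ : measurable J.
  apply: bigcapT_measurable => C; apply: bigcupT_measurable => n.
  rewrite -[X in measurable X]setTI; apply: measurable_fun_ltr => //.
  exact: measurable_walk_max.
have step v n : walk_max n.+1 v - walk_max n (shift 1 v) =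
    Num.max (f (v 0%N)) (- walk_max n (shift 1 v)).
  by rewrite /= addr_maxl sub0r addrK maxC.
have Jinv : shift 1 @^-1` J = J.
  have nb (a : R) : exists C : nat, a <= C%:R.
    by exists (Num.truncn a).+1; rewrite ltW// truncnS_gt.
  apply/seteqP; split => v Jv C _ /=.
    have [C' hC'] := nb (C%:R - f (v 0%N)); have [n _ /= hn] := Jv C' Logic.I.
    exists n.+1 => //=; rewrite lt_max -ltrBlDl (le_lt_trans hC')// orbT//.
  have [C' hC'] := nb (Num.max 0 (f (v 0%N) + C%:R)); have [n _ /= hn] := Jv C' Logic.I.
  case: n hn => [|n] /= hn; first by have := ler0n R C'; rewrite leNgt hn.
  exists n => //=; rewrite ltNge; apply/negP => h; move: hn; apply/negP.
  by rewrite -leNgt (le_trans _ hC')// ge_max le_max lexx le_max lerD2l h orbT.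
have [J0|J1] := shift_invariant01 mu_cylinder mJ Jinv.
  apply: ae_imply (prob0_ae mJ J0) _ => v nJ; apply: contrapT => h; apply: nJ => C _ /=.
  apply: contrapT => h'; apply: h; exists C%:R => n.
  rewrite (le_trans (walk_le_max n v))// leNgt; apply/negP => lt.
  by apply: h'; exists n.
exfalso; move: neg; apply/negP; rewrite -leNgt.
have mD n : measurable_fun [set: seqT] (fun v : seqT => walk_max n.+1 v - walk_max n (shift 1 v)).
  apply: measurable_funB; first exact: measurable_walk_max.
  by apply: measurable_comp_shift; exact: measurable_walk_max.
have mF : measurable_fun [set: seqT] (fun v : seqT => (f (v 0%N))%:E).
  by apply/measurable_EFinP; exact: measurable_step.
have to_f : {ae mu, forall v : seqT, setT v ->
    (walk_max n.+1 v - walk_max n (shift 1 v))%:E @[n --> \oo] --> (f (v 0%N))%:E}.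
  apply: ae_imply (prob1_ae mJ J1) _ => v; rewrite -Jinv => Jv _.
  have [n _ /= hn] := Jv (Num.truncn (- f (v 0%N))).+1 Logic.I.
  apply: cvg_near_cst; exists n => // m /= nm; congr EFin.
  rewrite step; apply/max_idPl; rewrite lerNl.
  rewrite (le_trans (ltW (truncnS_gt _)))// (le_trans (ltW hn))//.
  exact: walk_max_homo.
(* the differences are dominated because walk_max is nonnegative *)
have dom : {ae mu, forall (v : seqT) n, setT v ->
    (`|(walk_max n.+1 v - walk_max n (shift 1 v))%:E| <= `|(f (v 0%N))%:E|)%E}.
  apply: aeW => v n _; rewrite step lee_fin.
  exact: norm_max_opp_le (walk_max_ge0 _ _).
have [_ _ cv] := dominated_convergence measurableT
  (fun n => (measurable_EFinP _ _).2 (mD n)) mF to_f (integrable_abse f_int) dom.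
apply: cvge_ge cv; apply: nearW => n /=.
have [is1 is2] := integrable_shift (integrable_walk_max n).
under eq_integral do rewrite EFinB.
rewrite (integralB measurableT (integrable_walk_max n.+1) is1).
rewrite -/(integral (walk_max n.+1)) -/(integral (walk_max n \o shift 1)) is2.
have fin : integral (walk_max n) \is a fin_num.
  have := @integrable_fin_num _ seqT R mu setT measurableT _ (integrable_walk_max n). exact.
rewrite sube_ge0 ?fin ?orbT//.
apply: le_integral => //; [exact: integrable_walk_max|exact: integrable_walk_max|].
by move=> v _; rewrite lee_fin walk_max_incr.
Qed.

(** Suppose that the walk tends to minus infinity almost everywhere and let [M] be
    its supremum. Then [M v - M (shift 1 v) = max (f (v 0)) (- M (shift 1 v))]
    has integral zero: this holds for the truncations of [M] by invariance, and
    the differences are dominated by [f]. As the integral of [f] is nonnegative,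
    the maximum is [f (v 0)] almost everywhere, also along the orbit, and hence
    [M v = walk k v + M (shift k v)] for all [k]. When all sums after time [k]
    are at most [-1], the right-hand side is at most [-1], whereas [M] is
    nonnegative. *)
Lemma walk_not_to_ninfty : (0 <= integral (fun v => f (v 0%N)))%E ->
  {ae mu, forall v, ~ to_ninfty v}.
Proof.
move=> pos.
pose J : set seqT := \bigcap_(C : nat) \bigcup_N \bigcap_k [set v | walk (N + k) v <= - C%:R].
have JE v : J v <-> to_ninfty v.
  split=> [h C|h C _].
    have [N _ hN] := h C Logic.I; exists N => n /subnKC <-; exact: hN.
  by have [N hN] := h C; exists N => // k _ /=; apply: hN; exact: leq_addr.
have mJ : measurable J.
  apply: bigcapT_measurable => C; apply: bigcupT_measurable => N; apply: bigcapT_measurable => k.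
  rewrite -[X in measurable X]setTI; apply: measurable_fun_ler => //.
  exact: measurable_walk.
have Jinv : shift 1 @^-1` J = J.
  by apply/seteqP; split => v /= /JE h; apply/JE; apply/to_ninfty_shift.
have [J0|J1] := shift_invariant01 mu_cylinder mJ Jinv.
  by apply: ae_imply (prob0_ae mJ J0) _ => v nJ /JE.
have aeJ : {ae mu, forall v, to_ninfty v} by apply: ae_imply (prob1_ae mJ J1) _ => v /JE.
exfalso.
pose D v := walk_sup v - walk_sup (shift 1 v).
have mD : measurable_fun [set: seqT] (D : seqT -> R).
  apply: measurable_funB; first exact: measurable_walk_sup.
  by apply: measurable_comp_shift; exact: measurable_walk_sup.
pose h (K : nat) v := Num.min (walk_sup v) K%:R - Num.min (walk_sup (shift 1 v)) K%:R.
have mmin (K : nat) : measurable_fun [set: seqT] (fun v : seqT => Num.min (walk_sup v) K%:R).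
  by apply: measurable_minr => //; exact: measurable_walk_sup.
have mh K : measurable_fun [set: seqT] (h K : seqT -> R).
  by apply: measurable_funB; [exact: mmin|exact: (measurable_comp_shift 1 (mmin K))].
have to_D : {ae mu, forall v : seqT, setT v -> (h K v)%:E @[K --> \oo] --> (D v)%:E}.
  apply: aeW => v _; apply: cvg_near_cst.
  pose a := Num.max (walk_sup v) (walk_sup (shift 1 v)).
  exists (Num.truncn a).+1 => // K /= aK; congr EFin; rewrite /h /D.
  have : a <= K%:R by rewrite (le_trans (ltW (truncnS_gt _)))// ler_nat.
  by rewrite ge_max => /andP[/min_idPl -> /min_idPl ->].
have dom : {ae mu, forall (v : seqT) K, setT v -> (`|(h K v)%:E| <= `|(f (v 0%N))%:E|)%E}.
  apply: ae_imply aeJ _ => v Jv K _; rewrite lee_fin (le_trans (min_lipschitz _ _ _))//.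
  by rewrite walk_sup_step// norm_max_opp_le// walk_sup_nneg.
have [iD _ cv] := dominated_convergence measurableT
  (fun n => (measurable_EFinP _ _).2 (mh n)) ((measurable_EFinP _ _).2 mD)
  to_D (integrable_abse f_int) dom.
have imin (K : nat) : integrable (fun v => Num.min (walk_sup v) K%:R).
  have m0 : (0 <= K%:R :> R) by exact: ler0n.
  apply: (le_integrable _ _ _ (finite_measure_integrable_cst mu K%:R measurableT)) => //.
    exact/measurable_EFinP.
  move=> v _; rewrite /= lee_fin !ger0_norm// ?ge_min ?lexx ?orbT//.
  by rewrite le_min m0 walk_sup_nneg.
have int_D : integral D = 0%E.
  rewrite /integral -(cvg_lim (@ereal_hausdorff R) cv); apply: lim_near_cst => //.
  apply: nearW => K /=; under eq_integral do rewrite EFinB.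
  have [is1 is2] := integrable_shift (imin K).
  rewrite (integralB measurableT (imin K) is1).
  rewrite -/(integral (fun v => Num.min (walk_sup v) K%:R)).
  rewrite -/(integral ((fun v => Num.min (walk_sup v) K%:R) \o shift 1)) is2 subee//.
  by have := @integrable_fin_num _ seqT R mu setT measurableT _ (imin K).
pose G v := D v - f (v 0%N).
have mG : measurable_fun [set: seqT] (EFin \o (G : seqT -> R)).
  by apply/measurable_EFinP; apply: measurable_funB => //; exact: measurable_step.
have G_ge0 : {ae mu, forall v, 0 <= G v}.
  apply: ae_imply aeJ _ => v Jv; rewrite /G /D walk_sup_step// subr_ge0 le_max lexx//.
have absG : (\int[mu]_v `|(G v)%:E| = 0)%E.
  apply/eqP; rewrite eq_le integral_ge0// andbT.
  rewrite (_ : (\int[mu]_v `|(G v)%:E|) = \int[mu]_v (G v)%:E)%E; last first.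
    apply: ae_eq_integral => //; first by apply: measurableT_comp.
    by apply: ae_imply G_ge0 _ => v G0 _; rewrite /= ger0_norm.
  rewrite /G; under eq_integral do rewrite EFinB.
  rewrite (integralB measurableT iD f_int) -/(integral D) int_D sub0e.
  by rewrite -/(integral (fun v => f (v 0%N))) oppe_le0.
have DF : {ae mu, forall v : seqT, D v = f (v 0%N)}.
  have := (ae_eq_integral_abs mu measurableT mG).1 absG.
  move=> G0; apply: ae_imply G0 _ => v /(_ Logic.I) /= [] /eqP.
  by rewrite subr_eq0 => /eqP.
have DFk : {ae mu, forall v : seqT, forall k, D (shift k v) = f (v k)}.
  apply: ae_forall_nat => k; apply: ae_imply (ae_shift mu_cylinder k DF) _ => v ->.
  by rewrite /shift addn0.
have [N [mN N0 Nsub]] := ae_and aeJ DFk.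
suff NT : N = setT.
  have N1 : mu N = 1%E by rewrite NT; exact: probability_setT.
  by have /eqP := etrans (esym N1) N0; rewrite onee_eq0.
apply/seteqP; split => // v _; apply: Nsub => /= -[Jv Dv].
have sumE k : walk_sup v = walk k v + walk_sup (shift k v).
  elim: k => [|k IH]; first by rewrite shift0 /walk big_geq ?add0r.
  rewrite IH /walk big_nat_recr//= -/(walk k v) -addrA; congr (_ + _).
  by have := Dv k; rewrite /D shiftD addn1 => /eqP; rewrite subr_eq => /eqP.
have [M hM] := Jv 1%N.
have : walk_sup (shift M v) <= - 1 - walk M v.
  apply: walk_sup_le => n; apply: walk_max_le => k.
  by rewrite lerBrDl -walkD; apply: hM; exact: leq_addr.
have := sumE M; have := walk_sup_nneg v; lra.
Qed.

End Walk.

(** * Walks with a possibly infinite drift *)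

Section Drift.
Variable R : realType.
Notation seqT := (g_sigma_algebraType (@cylinders R)).
Variables (mu : probability seqT R) (rho : set R -> \bar R).
Hypothesis mu_cylinder : forall n B, (forall i, measurable (B i)) ->
  mu (cylinder n B) = (\prod_(0 <= i < n) rho (B i))%E.
Variable g : R -> R.
Hypothesis mg : measurable_fun [set: R] g.

Let g0 (v : seqT) : R := g (v 0%N).

Hypothesis g_pos : (\int[mu]_v (Num.max (g0 v) 0)%:E < +oo)%E.

Let E : \bar R := (\int[mu]_v (g0 v)%:E)%E.

Let mg0 : measurable_fun [set: seqT] g0.
Proof. exact: measurable_step. Qed.

Let mpos : measurable_fun [set: seqT] (fun v => Num.max (g0 v) 0).
Proof. by apply: measurable_maxr. Qed.

Let mneg : measurable_fun [set: seqT] (fun v => Num.max (- g0 v) 0).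
Proof. by apply: measurable_maxr => //; apply: measurableT_comp. Qed.

Let pos_ge0 : (0 <= \int[mu]_v (Num.max (g0 v) 0)%:E)%E.
Proof. by apply: integral_ge0 => v _; rewrite lee_fin le_max lexx orbT. Qed.

Let neg_ge0 : (0 <= \int[mu]_v (Num.max (- g0 v) 0)%:E)%E.
Proof. by apply: integral_ge0 => v _; rewrite lee_fin le_max lexx orbT. Qed.

Let E_split : E = (\int[mu]_v (Num.max (g0 v) 0)%:E - \int[mu]_v (Num.max (- g0 v) 0)%:E)%E.
Proof.
rewrite /E integralE; congr (_ - _)%E; apply: eq_integral => v _.
  by rewrite funeposE EFin_max.
by rewrite funenegE -EFinN EFin_max.
Qed.

Let integrable_of_neg : (\int[mu]_v (Num.max (- g0 v) 0)%:E < +oo)%E ->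
  mu.-integrable setT (EFin \o g0).
Proof.
move=> neg; apply/integrableP; split; first exact/measurable_EFinP.
rewrite (_ : (\int[mu]_x _) = \int[mu]_v ((Num.max (g0 v) 0)%:E + (Num.max (- g0 v) 0)%:E))%E.
  rewrite ge0_integralD//; last 4 first.
  - by move=> v _; rewrite lee_fin le_max lexx orbT.
  - exact/measurable_EFinP.
  - by move=> v _; rewrite lee_fin le_max lexx orbT.
  - exact/measurable_EFinP.
  by rewrite lte_add_pinfty.
apply: eq_integral => v _ /=; rewrite -EFinD; congr EFin.
have [h|h] := leP 0 (g0 v).
  by rewrite ger0_norm// (max_idPr _) ?addr0// oppr_le0.
by rewrite ltr0_norm// (max_idPl _) ?add0r// oppr_ge0 ltW.
Qed.

Let E_fin_integrable : E \is a fin_num -> mu.-integrable setT (EFin \o g0).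
Proof.
rewrite E_split => h; apply: integrable_of_neg.
by move: h; rewrite fin_numB => /andP[_ /fin_numPlt /andP[]].
Qed.

Let integral_const (a : R) : (\int[mu]_(v in [set: seqT]) a%:E = a%:E)%E.
Proof.
have -> := integral_cst mu (@measurableT _ seqT) a%:E.
by rewrite -[RHS]mule1; congr (_ * _)%E; exact: probability_setT.
Qed.

Lemma drift_lty : (E < +oo)%E.
Proof.
rewrite E_split; apply: le_lt_trans g_pos.
by rewrite -[leRHS]sube0 leeB.
Qed.

(** The lower half of the strong law of large numbers: by [walk_bounded], the averages
    of [g] along the sequence are asymptotically at least [a]. *)
Lemma drift_bounded_below (a : R) : (a%:E < E)%E ->
  {ae mu, forall v, exists C, forall n, walk (fun r => a - g r) n v <= C}.
Proof.
move=> aE; have Efin : E \is a fin_num.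
  by rewrite fin_real// (lt_trans _ aE) ?ltNyr//= drift_lty.
have ig := E_fin_integrable Efin.
have ia := finite_measure_integrable_cst mu a (@measurableT _ seqT).
apply: (walk_bounded _ mu_cylinder); last 1 first.
- under eq_integral do rewrite EFinB.
  rewrite (integralB measurableT ia ig) -/E integral_const.
  by rewrite sube_lt0.
- by apply: measurable_funB.
- exact: (integrableB measurableT ia ig).
Qed.

(** When the negative part of [g] has infinite integral, it is truncated so that the
    truncated variable still has expectation at most [c]. *)
Lemma drift_not_to_ninfty (c : R) : (E <= c%:E)%E ->
  {ae mu, forall v, ~ to_ninfty (fun r => c - g r) v}.
Proof.
move=> Ec.
suff [f [mf fg [fi f0]]] : exists f : R -> R, [/\ measurable_fun [set: R] f,
    forall r, f r <= c - g r & mu.-integrable setT (fun v => (f (v 0%N))%:E) /\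
    (0 <= \int[mu]_v (f (v 0%N))%:E)%E].
  apply: ae_imply (walk_not_to_ninfty mf mu_cylinder fi f0) _ => v nf h; apply: nf => C.
  have [N hN] := h C; exists N => n Nn; apply: le_trans (hN n Nn).
  by apply: ler_sum => i _.
have ic := finite_measure_integrable_cst mu c (@measurableT _ seqT).
have [neg|neg] := ltP (\int[mu]_v (Num.max (- g0 v) 0)%:E)%E +oo%E.
  have ig := integrable_of_neg neg.
  exists (fun r => c - g r); split => //; first exact: measurable_funB.
  split; first exact: (integrableB measurableT ic ig).
  under eq_integral do rewrite EFinB.
  rewrite (integralB measurableT ic ig) -/E integral_const.
  rewrite sube_ge0//; by rewrite orbC.
have negoo : (\int[mu]_v (Num.max (- g0 v) 0)%:E = +oo)%E by apply/eqP; rewrite -leye_eq.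
(* the truncated function is c - max g 0 + min (max (- g) 0) K, with K so
   large that its integral is nonnegative *)
pose u (K : nat) (v : seqT) : R := Num.min (Num.max (- g0 v) 0) K%:R.
have mu_ K : measurable_fun [set: seqT] (u K) by apply: measurable_minr.
have u_ge0 K v : 0 <= u K v by rewrite le_min le_max lexx orbT ler0n.
have u_lim : (\int[mu]_v (u K v)%:E)%E @[K --> \oo] --> +oo%E.
  rewrite -negoo.
  have lim_u v : limn (fun K => (u K v)%:E) = (Num.max (- g0 v) 0)%:E.
    apply: lim_near_cst => //.
    exists (Num.truncn (Num.max (- g0 v) 0)).+1 => // K /= hK; congr EFin.
    by apply/min_idPl; rewrite (le_trans (ltW (truncnS_gt _)))// ler_nat.
  rewrite (eq_integral (fun v => limn (fun K => (u K v)%:E))); last by move=> v _; rewrite lim_u.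
  apply: (@cvg_monotone_convergence _ seqT R mu setT measurableT (fun K v => (u K v)%:E)).
  - by move=> K; exact/measurable_EFinP.
  - by move=> K v _; rewrite lee_fin.
  - move=> v _ m n mn; rewrite lee_fin /u le_min ge_min lexx /= ge_min.
    by rewrite ler_nat mn orbT.
pose p := (\int[mu]_v (Num.max (g0 v) 0)%:E)%E.
have pE : p = (fine p)%:E by rewrite fineK// fin_real// g_pos (lt_le_trans _ pos_ge0)// ltNyr.
have [K hK] : exists K, ((fine p - c)%:E <= \int[mu]_v (u K v)%:E)%E.
  have /cvgeyPge /(_ (fine p - c)) [K _ hK] := u_lim.
  by exists K; apply: hK => /=.
exists (fun r => c + Num.min (Num.max (- g r) 0) K%:R - Num.max (g r) 0).
have ipos : mu.-integrable [set: seqT] (fun v => (Num.max (g0 v) 0)%:E).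
  apply/integrableP; split; first exact/measurable_EFinP.
  under eq_integral do rewrite abse_EFin ger0_norm ?le_max ?lexx ?orbT//.
  exact: g_pos.
have iu : mu.-integrable [set: seqT] (fun v => (u K v)%:E).
  apply: (le_integrable _ _ _ (finite_measure_integrable_cst mu K%:R measurableT)) => //.
    exact/measurable_EFinP.
  move=> v _; rewrite /= lee_fin !ger0_norm// ?ge_min ?lexx ?orbT//.
split.
- apply: measurable_funB; last exact: measurable_maxr.
  apply: measurable_funD => //; apply: measurable_minr => //; apply: measurable_maxr => //.
  exact: measurableT_comp.
- move=> r; have : Num.min (Num.max (- g r) 0) K%:R <= Num.max (- g r) 0 by rewrite ge_min lexx.
  have [|] := leP (- g r) 0; have [|] := leP (g r) 0; lra.
have icu : mu.-integrable [set: seqT] (fun v => c%:E + (u K v)%:E)%E.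
  exact: (integrableD measurableT ic iu).
split; first exact: (integrableB measurableT icu ipos).
under eq_integral do rewrite EFinB EFinD.
rewrite (integralB measurableT icu ipos) (integralD measurableT ic iu) integral_const.
rewrite -/p pE; rewrite sube_ge0 ?fin_numE//.
by rewrite -leeBlDl// -EFinB.
Qed.

End Drift.

(** * Products of weights *)

(** This turns the growth of the formal eigenvectors of the adjoint into a question
    on random walks. *)
Lemma expR_walk_wprod (R : realType) (a : R) (x : nat -> R) n : (forall n, 0 < x n) ->
  expR (walk (fun r => a - ln r) n x) * wprod x n = expR a ^+ n.
Proof.
move=> x0; elim: n => [|n IH]; first by rewrite /walk big_geq// expR0 wprod0 mulr1.
rewrite /walk big_nat_recr//= -/(walk _ n x) wprodS expRD mulrACA IH expRB lnK ?posrE//.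
by rewrite divfK ?gt_eqF// exprSr.
Qed.

Lemma geometric_bound_of_walk_bounded (R : realType) (a q C : R) (x : nat -> R) :
  (forall n, 0 < x n) -> (forall n, walk (fun r => a - ln r) n x <= C) ->
  0 <= q -> q < expR a ->
  exists C q' : R, 0 <= q' < 1 /\ forall n, q ^+ n <= C * q' ^+ n * wprod x n.
Proof.
move=> x0 h q0 qa; have ea := expR_gt0 a.
exists (expR C), (q / expR a); split.
  by rewrite divr_ge0 ?expR_ge0//= ltr_pdivrMr ?mul1r.
move=> n; rewrite expr_div_n -(expR_walk_wprod a n x0) in ea *.
have w0 := wprod_gt0 n x0.
have -> : expR C * (q ^+ n / (expR (walk (fun r => a - ln r) n x) * wprod x n)) * wprod x n =
    expR C / expR (walk (fun r => a - ln r) n x) * q ^+ n.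
  by field; rewrite !gt_eqF ?expR_gt0.
rewrite ler_peMl ?exprn_ge0// ler_pdivlMr ?expR_gt0// mul1r ler_expR.
exact: h.
Qed.

Lemma to_ninfty_of_small (R : realType) (q : R) (x : nat -> R) :
  (forall n, 0 < x n) -> 0 < q ->
  (forall eps : R, 0 < eps -> exists N, forall n, (N <= n)%N -> q ^+ n <= eps * wprod x n) ->
  to_ninfty (fun r => ln q - ln r) x.
Proof.
move=> x0 q0 h C; have [N hN] := h (expR (- C%:R)) (expR_gt0 _).
exists N => n /hN; rewrite -{1}(lnK (q0 : q \is Num.pos)) -(expR_walk_wprod _ n x0).
by rewrite ler_pM2r ?wprod_gt0// ler_expR.
Qed.

(** * The law of the sequence of weights *)

Section Path.
Variables (d : measure_display) (Omega : measurableType d) (R : realType).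
Variables (P : probability Omega R) (X : nat -> {RV P >-> R}).
Notation seqT := (g_sigma_algebraType (@cylinders R)).

Definition path (w : Omega) : nat -> R := fun n => X n w.

Lemma path_cylinder n B : path @^-1` cylinder n B =
  \bigcap_(i in [set` [fset i | i in iota 0 n]%fset]) (X i @^-1` B i).
Proof.
apply/seteqP; split => w h i.
  by rewrite /= !inE mem_iota /= => ilt; exact: h.
by move=> ilt; apply: h; rewrite /= !inE mem_iota.
Qed.

Lemma measurable_path : measurable_fun [set: Omega] (path : Omega -> seqT).
Proof.
apply: (@measurability _ _ Omega seqT setT path (@cylinders R) erefl) => _ [_ [n [B [mB ->]]] <-].
rewrite setTI path_cylinder; apply: fin_bigcap_measurable; first exact: finite_fset.
by move=> i _; rewrite -[X in measurable X]setTI; apply: measurable_funP.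
Qed.

Definition path_mfun : {mfun Omega >-> seqT} :=
  HB.pack (path : Omega -> seqT) (isMeasurableFun.Build _ _ _ _ _ measurable_path).

Definition path_law : probability seqT R := distribution P path_mfun.

Lemma path_lawE A : path_law A = P (path @^-1` A).
Proof. by []. Qed.

Lemma ae_path (Q : (nat -> R) -> Prop) : {ae path_law, forall v, Q v} ->
  {ae P, forall w, Q (path w)}.
Proof.
move=> [N [mN N0 Nsub]]; exists (path @^-1` N); split => //.
  by rewrite -[X in measurable X]setTI; exact: measurable_path.
by move=> w /Nsub.
Qed.

Hypothesis X_indep : mutually_independent X.
Hypothesis X_ident : identically_distributed X.

Let rho := distribution P (X 0%N).

Lemma path_law_cylinder n (B : nat -> set R) : (forall i, measurable (B i)) ->
  path_law (cylinder n B) = (\prod_(0 <= i < n) rho (B i))%E.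
Proof.
move=> mB; rewrite path_lawE path_cylinder X_indep//.
rewrite (perm_big (index_iota 0 n)); last first.
  apply: uniq_perm; [exact: fset_uniq|exact: iota_uniq|move=> i].
  by rewrite !inE /index_iota subn0.
by apply: eq_bigr => i _; exact: (X_ident i (mB i)).
Qed.

Lemma ae_avoid n (B : set R) : measurable B -> rho B = 0%E -> {ae P, forall w, ~ B (X n w)}.
Proof.
move=> mB B0; exists (X n @^-1` B); split.
- by rewrite -[X in measurable X]setTI; apply: measurable_funP.
- by have := X_ident n mB; rewrite -/rho B0.
- by move=> w /contrapT.
Qed.

Lemma ae_windows N (B : nat -> set R) : (forall i, measurable (B i)) ->
  (forall i, (0 < rho (B i))%E) ->
  {ae P, forall w, forall M, exists2 n, (M <= n)%N & forall k, (k < N)%N -> B k (X (n + k)%N w)}.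
Proof.
move=> mB B0; apply: (@ae_path (fun v => forall M, exists2 n, (M <= n)%N &
    forall k, (k < N)%N -> B k (v (n + k)%N))).
apply: (windows_io path_law_cylinder mB).
rewrite path_law_cylinder//; elim/big_ind: _ => // a b; exact: mule_gt0.
Qed.

(** The complement of the essential range is covered by countably many null balls
    with rational centres. *)
Lemma ae_essran n : {ae P, forall w, essran (X 0%N) (X n w)}.
Proof.
pose F (k : nat) : set R := if choice.unpickle k is Some (q, m) then
   let B := ball (ratr (q : rat) : R) (m.+1%:R^-1) in if rho B == 0%E then B else set0
  else set0.
have mF k : measurable (F k).
  by rewrite /F; case: choice.unpickle => [[q m]|//] /=; case: ifP => // _; exact: measurable_ball.
have F0 k : rho (F k) = 0%E.
  rewrite /F; case: choice.unpickle => [[q m]|] /=; last exact: measure0.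
  by case: ifP => [/eqP//|_]; exact: measure0.
have := ae_forall_nat (fun k => ae_avoid n (mF k) (F0 k)) => h.
apply: ae_imply h _ => w nF eps e0; apply: contrapT => /negP; rewrite -leNgt => rho0.
have [m hm] : exists m : nat, m.+1%:R^-1 < eps / 2.
  exists (Num.truncn (eps / 2)^-1); rewrite invf_plt ?posrE ?divr_gt0//.
  exact: truncnS_gt.
pose r : R := m.+1%:R^-1; rewrite -/r in hm.
have r0 : 0 < r by rewrite invr_gt0.
have [q] : exists q : rat, ratr q \in `]X n w, X n w + r[.
  by apply: rat_in_itvoo; rewrite ltrDl.
rewrite in_itv /= => /andP[q1 q2].
have sub : ball (ratr q : R) r `<=` ball (X n w) eps.
  move=> y; rewrite -!ball_normE /= => h.
  have h2 : `|X n w - ratr q| <= r by rewrite distrC ger0_norm ?subr_ge0 ?(ltW q1)// lerBlDl ltW.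
  rewrite (le_lt_trans (ler_distD (ratr q) _ _))//.
  by move: h h2 hm; clear; move: r `|X n w - ratr q| `|ratr q - y| => r a b; lra.
apply: (nF (choice.pickle (q, m))); rewrite /F choice.pickleK /= -/r.
have -> : (rho (ball (ratr q : R) r) == 0)%E.
  rewrite eq_le measure_ge0 andbT; apply: le_trans rho0; apply: le_measure => //.
  - by rewrite inE; exact: measurable_ball.
  - by rewrite inE; exact: measurable_ball.
by rewrite -/r -ball_normE /= ger0_norm ?subr_ge0 ?(ltW q1)// ltrBlDl.
Qed.

(** The negative part may have infinite integral, so the image measure formula is
    applied to the positive and negative parts separately. *)
Lemma expectation_ln_path : {ae P, forall w, 0 < X 0%N w} ->
  expectation_ln (X 0%N) = (\int[path_law]_v (ln (v 0%N))%:E)%E.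
Proof.
move=> X_gt0; have mX : measurable_fun [set: Omega] (X 0%N) by apply: measurable_funP.
have mlnX : measurable_fun [set: Omega] (fun w => (ln (X 0%N w))%:E).
  by apply/measurable_EFinP; apply: measurableT_comp.
have mln0 : measurable_fun [set: seqT] (fun v : seqT => (ln (v 0%N))%:E).
  apply/measurable_EFinP; apply: measurableT_comp => //; exact: measurable_coord.
rewrite /expectation_ln (ae_eq_integral (fun w => (ln (X 0%N w))%:E)) => //; last 2 first.
- apply: measurable_fun_ifT => //.
  by apply: measurable_fun_ler.
- by apply: ae_imply X_gt0 _ => w Xw _; rewrite lne_EFin.
have mp := measurable_path.
rewrite integralE [RHS]integralE; congr (_ - _)%E.
  rewrite ge0_integral_pushforward//; last exact: measurable_funepos.
  by apply: eq_integral => w _; rewrite /= !funeposE.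
rewrite ge0_integral_pushforward//; last exact: measurable_funeneg.
by apply: eq_integral => w _; rewrite /= !funenegE.
Qed.

(** Since [ln r <= r] for positive [r]. *)
Lemma ln_pos_integral (b : R) : 0 <= b -> {ae P, forall w, X 0%N w <= b} ->
  (\int[path_law]_v (Num.max (ln (v 0%N)) 0)%:E < +oo)%E.
Proof.
move=> b0 Xb.
have mm : measurable_fun [set: seqT] (fun v : seqT => (Num.max (ln (v 0%N)) 0)%:E).
  apply/measurable_EFinP; apply: measurable_maxr => //.
  by apply: measurableT_comp => //; exact: measurable_coord.
rewrite ge0_integral_pushforward//; last first.
  by move=> v _; rewrite lee_fin le_max lexx orbT.
apply: (@le_lt_trans _ _ (\int[P]_w (cst b%:E w))%E); last first.
  have -> : (\int[P]_w (cst b%:E w) = b%:E)%E.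
    by rewrite integral_cst// -[RHS]mule1; congr (_ * _)%E; exact: probability_setT.
  exact: ltry.
rewrite preimage_setT.
apply: ae_ge0_le_integral => //.
- by move=> w _; rewrite lee_fin le_max lexx orbT.
- exact: (measurableT_comp mm measurable_path).
apply: ae_imply Xb _ => w Xw _; rewrite /= lee_fin ge_max b0 andbT.
have [X0|X0] := ltP 0 (X 0%N w); last by rewrite ln0.
by rewrite (le_trans (ltW (ln_sublinear X0))).
Qed.

End Path.

(** * The theorem *)

Unset Implicit Arguments.
Set Strict Implicit.
Set Printing Implicit Defensive.

(* Sequences are indexed from 0: X_n and e_n (n >= 1) are X (n - 1) and e (n - 1). *)
Theorem theorem3p1 (R : realType)
  (H : completeNormedModType R[i]) (dot : {dot H for @Num.conj R[i]})
  (dot_norm : induces_norm dot)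
  (e : nat -> H) (e_onb : orthonormal_basis dot e)
  (d : measure_display) (Omega : measurableType d) (P : probability Omega R)
  (X : nat -> {RV P >-> R})
  (X_ge0 : forall n, nonneg_as (X n))
  (X_bounded : forall n, bounded_as (X n))
  (X_indep : mutually_independent X)
  (X_ident : identically_distributed X)
  (T : Omega -> {linear H -> H})
  (T_bounded : forall w, continuous (T w))
  (T_shift : {ae P, forall w, forall n, T w (e n) = (X n w)%:C *: e n.+1})
  (rmin rmax : R)
  (rmin_min : essran (X 0%N) rmin /\ lbound (essran (X 0%N)) rmin)
  (rmax_max : essran (X 0%N) rmax /\ ubound (essran (X 0%N)) rmax)
  (rmax_gt0 : 0 < rmax) :
  (* (i) *)
  {ae P, forall w,
    [/\ op_norm (T w) = rmax, ess_norm (T w) = rmax,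
        spectral_radius (T w) = rmax & num_radius dot (T w) = rmax]} /\
  (* (ii) *)
  {ae P, forall w,
    spectrum (T w) = cdisc0 rmax /\
    surjectivity_spectrum (T w) = cdisc0 rmax} /\
  (* (iii) *)
  {ae P, forall w,
    [/\ approx_point_spectrum (T w) = annulus0 rmin rmax,
        ess_spectrum dot (T w) = annulus0 rmin rmax
      & lre_spectrum dot (T w) = annulus0 rmin rmax]} /\
  {ae P, forall w, forall l : R[i], odisc0 rmin l ->
    op_index dot (sub_scalar (T w) l) = (-1)%:E} /\
  (* (iv) *)
  ((0 < P [set w | X 0%N w = 0%R])%E ->
   {ae P, forall w,
     [/\ point_spectrum (T w) = [set 0],
         point_spectrum (adjoint dot (T w)) = [set 0],
         dimension (op_ker (T w)) = +oo%E
       & dimension (op_ker (adjoint dot (T w))) = +oo%E]}) /\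
  (* (v) *)
  (P [set w | X 0%N w = 0%R] = 0%E ->
   {ae P, forall w,
     [/\ point_spectrum (T w) = set0,
         point_spectrum (adjoint dot (T w)) =
           [set 0] `|`
           [set l | ((rnorm l)%:E < expeR (expectation_ln (X 0%N)))%E]
       & forall l, point_spectrum (adjoint dot (T w)) l ->
           dimension (op_ker (sub_scalar (adjoint dot (T w)) l)) = 1%:E]}) /\
  (* (vi) *)
  {ae P, forall w, num_range dot (T w) = odisc0 rmax} /\
  {ae P, forall w, ess_num_range dot (T w) = cdisc0 rmax}.
Proof.
have X_ess := ae_forall_nat (ae_essran X_ident).
have X_bnd : {ae P, forall w, forall n, rmin <= X n w <= rmax}.
  apply: ae_imply X_ess _ => w Xw n.
  by rewrite (rmin_min.2 _ (Xw n)) (rmax_max.2 _ (Xw n)).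
have rmin_ge0 : 0 <= rmin.
  rewrite leNgt; apply/negP => rlt.
  have r0 : 0 < - rmin by rewrite oppr_gt0.
  have := rmin_min.1 _ r0; rewrite ltNge => /negP; apply.
  have [N [mN N0 Nsub]] := X_ge0 0%N.
  rewrite -N0; apply: (@le_measure _ _ _ P); rewrite ?inE//.
    have mX : measurable_fun [set: Omega] (X 0%N) by apply: measurable_funP.
    by rewrite -[X in measurable X]setTI; apply: mX => //; exact: measurable_ball.
  move=> w; rewrite /= -ball_normE /= => h; apply: Nsub => /= X0.
  move: h; rewrite distrC ger0_norm; first by rewrite ltrBlDr addNr ltNge X0.
  by rewrite subr_ge0 (le_trans (ltW rlt)).
have windows : {ae P, forall w, forall (N M : nat) (eps : R), 0 < eps ->
  exists2 n0, (M <= n0)%N & forall k, (k < N + N)%N ->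
    `|X (n0 + k)%N w - (if (k < N)%N then rmax else rmin)| < eps}.
  pose B N j k : set R := ball (if (k < N)%N then rmax else rmin) (j.+1%:R^-1 : R).
  have hB N j k : (0 < distribution P (X 0%N) (B N j k))%E.
    have j0 : (0 : R) < j.+1%:R^-1 by rewrite invr_gt0.
    by rewrite /B; case: ifP => _; [exact: rmax_max.1|exact: rmin_min.1].
  have h := ae_forall_nat (fun N => ae_forall_nat (fun j =>
    ae_windows X_indep X_ident (N + N) (fun k => measurable_ball _ _) (hB N j))).
  apply: ae_imply h _ => w hw N M eps e0.
  have [n Mn hn] := hw N (Num.truncn eps^-1) M; exists n => // k kN.
  have := hn k kN; rewrite /B -ball_normE /= distrC => /lt_le_trans; apply.
  by rewrite invf_ple ?posrE// ltW// truncnS_gt.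
have zeros : (0 < P [set w | X 0%N w = 0%R])%E -> {ae P, forall w, zeros_io (X ^~ w)}.
  move=> p0; have m0 := measurable_set1 (0 : R).
  have h := ae_windows X_indep X_ident 1 (fun _ => m0) (fun _ => p0).
  apply: ae_imply h _ => w hw M; have [n Mn hn] := hw M; exists n => //.
  by have := hn 0%N (ltnSn _); rewrite addn0.
have positive : P [set w | X 0%N w = 0%R] = 0%E -> {ae P, forall w, forall n, 0 < X n w}.
  move=> p0; have h := ae_forall_nat (fun n => ae_avoid X_ident n (measurable_set1 (0 : R)) p0).
  apply: ae_imply (ae_and h X_bnd) _ => w [hw bw] n.
  rewrite lt_def (le_trans rmin_ge0); last by case/andP: (bw n).
  by rewrite andbT; apply/eqP; exact: hw.
have dichotomy : {ae P, forall w, (forall n, 0 < X n w) \/ zeros_io (X ^~ w)}.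
  have [p0|p0] := eqVneq (P [set w | X 0%N w = 0%R]) 0%E.
    by apply: ae_imply (positive p0) _ => w; left.
  apply: ae_imply (zeros _) _ => [|w]; last by right.
  by rewrite lt0e p0 measure_ge0.
have good := ae_and T_shift (ae_and X_bnd (ae_and windows dichotomy)).
split.
  apply: ae_imply good _ => w [Ts [Xb [Xw _]]]; split.
  - exact: (op_normE dot_norm e_onb (T_bounded w) Ts rmin_ge0 rmax_gt0 Xb Xw).
  - exact: (ess_normE dot_norm e_onb (T_bounded w) Ts rmin_ge0 rmax_gt0 Xb Xw).
  - exact: (spectral_radiusE dot_norm e_onb (T_bounded w) Ts rmin_ge0 rmax_gt0 Xb Xw).
  - exact: (num_radiusE dot_norm e_onb (T_bounded w) Ts rmin_ge0 rmax_gt0 Xb Xw).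
split.
  apply: ae_imply good _ => w [Ts [Xb [Xw _]]]; split.
  - exact: (spectrumE dot_norm e_onb (T_bounded w) Ts rmin_ge0 rmax_gt0 Xb Xw).
  - exact: (surjectivity_spectrumE dot_norm e_onb (T_bounded w) Ts rmin_ge0 rmax_gt0 Xb Xw).
split.
  apply: ae_imply good _ => w [Ts [Xb [Xw dic]]]; split.
  - exact: (approx_point_spectrumE dot_norm e_onb (T_bounded w) Ts rmin_ge0 rmax_gt0 Xb Xw).
  - exact: (ess_spectrumE dot_norm e_onb (T_bounded w) Ts rmin_ge0 rmax_gt0 Xb Xw dic).
  - exact: (lre_spectrumE dot_norm e_onb (T_bounded w) Ts rmin_ge0 rmax_gt0 Xb Xw dic).
split.
  apply: ae_imply good _ => w [Ts [Xb _]] l.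
  exact: (op_index_inner dot_norm e_onb (T_bounded w) Ts rmin_ge0 rmax_gt0 Xb).
split.
  move=> /zeros z; apply: ae_imply (ae_and z good) _ => w [zw [Ts [Xb _]]].
  exact: (point_spectra_zeros dot_norm e_onb (T_bounded w) Ts rmin_ge0 rmax_gt0 Xb zw).
split; last first.
  split; apply: ae_imply good _ => w [Ts [Xb [Xw _]]].
    exact: (num_rangeE dot_norm e_onb (T_bounded w) Ts rmin_ge0 rmax_gt0 Xb Xw).
  exact: (ess_num_rangeE dot_norm e_onb (T_bounded w) Ts rmin_ge0 rmax_gt0 Xb Xw).
move=> /positive X_gt0.
set E := expectation_ln (X 0%N).
have X0_gt0 : {ae P, forall w, 0 < X 0%N w} by apply: ae_imply X_gt0 _ => w; exact.
have X0_le : {ae P, forall w, X 0%N w <= rmax}.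
  by apply: ae_imply X_bnd _ => w /(_ 0%N) /andP[].
have EE : E = (\int[path_law X]_v (ln (v 0%N))%:E)%E by exact: expectation_ln_path.
have lnpos := ln_pos_integral (ltW rmax_gt0) X0_le.
have cyl := path_law_cylinder X_indep X_ident.
have mln := @measurable_ln R.
(* rational levels, so that only countably many null events are discarded *)
have below : {ae P, forall w, forall q : rat, ((ratr q)%:E < E)%E ->
    exists C, forall n, walk (fun r => ratr q - ln r) n (X ^~ w) <= C}.
  have h k : {ae P, forall w, forall q : rat, choice.unpickle k = Some q -> ((ratr q)%:E < E)%E ->
     exists C, forall n, walk (fun r => ratr q - ln r) n (X ^~ w) <= C}.
    case: (choice.unpickle k) => [q|]; last by apply: aeW.
    have [qE|qE] := boolP ((ratr q)%:E < E)%E; last first.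
      by apply: aeW => w q' [<-] qE'; exfalso; exact: (negP qE).
    rewrite EE in qE; have h := ae_path (drift_bounded_below cyl mln lnpos qE).
    by apply: ae_imply h _ => w [C hC] q' [<-] _; exists C.
  apply: ae_imply (ae_forall_nat h) _ => w hw q.
  by apply: (hw (choice.pickle q)); rewrite choice.pickleK.
(* levels above E and arbitrarily close to it: E itself, or - j when E = -oo *)
pose c (j : nat) : R := if E \is a fin_num then fine E else - j%:R.
have above : {ae P, forall w, forall j, (E <= (c j)%:E)%E ->
    ~ to_ninfty (fun r => c j - ln r) (X ^~ w)}.
  apply: ae_forall_nat => j.
  have [jE|jE] := boolP (E <= (c j)%:E)%E; last first.
    by apply: aeW => w Ej; exfalso; exact: (negP jE).
  rewrite EE in jE; have h := ae_path (drift_not_to_ninfty cyl mln lnpos jE).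
  by apply: ae_imply h _ => w hw _.
have E_lty : (E < +oo)%E by rewrite EE; exact: (drift_lty lnpos).
apply: ae_imply (ae_and (ae_and below above) (ae_and X_gt0 good)) _ => w [[bw aw] [Xw [Ts [Xb _]]]].
apply: (point_spectra_pos dot_norm e_onb (T_bounded w) Ts rmin_ge0 rmax_gt0 Xb) => //.
  move=> q q0 qE.
  have [r qr rE] : exists2 r : rat, q < expR (ratr r) & ((ratr r)%:E < E)%E.
    move: qE E_lty; clear -q0; case: E => [a| |]//=; last by rewrite lte_fin ltNge q0.
    rewrite lte_fin => qa _; pose b := if 0 < q then ln q else a - 1.
    have ba : b < a.
      rewrite /b; case: ifPn => [qp|_]; last by rewrite ltrBlDr ltrDl.
      by rewrite -(expRK a) ltr_ln ?posrE ?expR_gt0.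
    have [r] := rat_in_itvoo ba; rewrite in_itv /= => /andP[br ra].
    exists r; last by rewrite lte_fin.
    move: br; rewrite /b; case: ifPn => [qp br|]; last first.
      by rewrite -leNgt => qn _; rewrite (le_lt_trans qn)// expR_gt0.
    by rewrite -(lnK (qp : q \is Num.pos)) ltr_expR.
  have [C hC] := bw r rE.
  exact: geometric_bound_of_walk_bounded hC q0 qr.
move=> q q0 Eq h.
have hq := to_ninfty_of_small Xw q0 h.
have [j [Ec cq]] : exists j, (E <= (c j)%:E)%E /\ c j <= ln q.
  move: Eq E_lty; rewrite /c; clear -q0; case: E => [a| |]//=.
    rewrite lee_fin => aq _; exists 0%N; split => //.
    by rewrite -ler_expR (lnK (q0 : q \is Num.pos)).
  move=> _ _; exists (Num.truncn (- ln q)).+1; split; first exact: leNye.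
  by rewrite lerNl ltW// truncnS_gt.
apply: (aw j Ec) => C; have [N hN] := hq C; exists N => n Nn; apply: le_trans (hN n Nn).
by apply: ler_sum => i _; rewrite lerB.
Qed.
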